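(* Let $f(z) = \sum_{n=0}^\infty a_n z^n$ be a complex power series with radius of convergence equal to $1$. Assume that $\lim_{n \rightarrow \infty} \frac{a_n}{a_{n+1}} = s$ for some $s \in \mathbb{C}$. Then $z = s$ is a singular point of $f$.
   Context: The assumption on the limit presupposes that $a_{n+1} \neq 0$ for all sufficiently large $n$, so that the quotients $a_n/a_{n+1}$ are defined for large $n$; since the radius of convergence is $1$, necessarily $|s| = 1$. A point $s$ with $|s|=1$ is a singular point of $f$ if $f$ cannot be analytically continued to a neighbourhood of $s$, i.e. there is no open disc $U$ centred at $s$ and holomorphic function $g$ on $\{|z|<1\} \cup U$ with $g = f$ on $\{|z|<1\}$. *)

(* Defs.v *)
From Stdlib Require Import Reals.
From Coquelicot Require Import Coquelicot.
Local Open Scope R_scope.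

(* The case of a complex sequence; Coquelicot's CV_radius is for real ones. *)
Definition is_CV_radius_C (a : nat -> C) (r : Rbar) : Prop :=
  (forall z : C, Rbar_lt (Cmod z) r -> ex_pseries (V := C_NormedModule) a z) /\
  (forall z : C, Rbar_lt r (Cmod z) -> ~ ex_pseries (V := C_NormedModule) a z).

(* Intended for open D only.  The base field of ex_derive is C_AbsRing, so this
   is complex differentiability; the values of g outside D play no role. *)
Definition holomorphic_on (D : C -> Prop) (g : C -> C) : Prop :=
  forall z : C, D z -> ex_derive (K := C_AbsRing) (V := C_NormedModule) g z.

(* Only the values of f on the open unit disc matter. *)
Definition singular_point (f : C -> C) (s : C) : Prop :=
  Cmod s = 1 /\
  ~ exists (r : posreal) (g : C -> C),
      holomorphic_on (fun z => Cmod z < 1 \/ Cmod (z - s) < r) g /\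
      (forall z : C, Cmod z < 1 -> g z = f z).

(* Main.v *)
Require Import Defs.
From Stdlib Require Import Reals Lra Lia ClassicalEpsilon.
From Coquelicot Require Import Coquelicot.
From mathcomp Require binomial.
Local Open Scope R_scope.

(** Rotating the variable turns the limit [s] into [1], so suppose that
[a_k / a_(k+1)] tends to [1], that the series converges on the open unit disc
and that its sum [g] is holomorphic near [1] too.  Take [y = 1 - d] with [d]
so small that the closed discs of radius [2 d] about the points [y e^(it)],
[|t| <= d], lie where [g] is holomorphic near [1].  Cauchy's estimate there
bounds the Taylor coefficients of [g] at [x = y e^(it)] by [M (2 d)^(-m)];
multiplied by [x^m] they read

  [sum_k A_k e^(ikt)],  [A_k = binom k m * y^k * a_k],

so this sum is at most [M (y / (2 d))^m] for [|t| <= d]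
([hasse_poly_bound_near_one]).  The disc of radius [d] about [y] is the largest
one inside the unit disc: that the radius is [2 d] is the whole gain.

Let [n] be an index at which [|A_k|] is maximal.  The weight [binom k m * y^k]
is largest at [k] close to [m / d], and since [a] varies slowly, maximality
forces [n] to be close to [m / d] as well ([peak_ratio]).  This has two
consequences.  Passing from [m] to [m + 1] multiplies [A_n] by
[(n - m) / (m + 1)], about [y / d], so the maximum grows faster than
[(y / (2 d))^m] ([peak_growth]).  And the ratios [A_k / A_(k+1)] are close to
[1] for [k] near [n], so [A_k] is close to [A_n] on any prescribed window about
[n], once [m] is large ([flat_near_peak]).

Finally average [sum_k A_k e^(i(k-n)t)] over finitely many points of the arc
[|t| <= d] with Fejer's nonnegative weights.  The resulting multipliers of the [A_k] are
nonnegative, equal to [1] at [k = n] and [O((k - n)^(-2))] uniformly.  The terms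
of the window have nonnegative real part relative to [A_n], those outside it
contribute at most half of [|A_n|]; hence [|A_n|] is at most twice the supremum
of the sum on the arc ([peak_le_arc_sup]).  So
[|A_n| <= 2 M (y / (2 d))^m], against the growth of the maximum.

Cauchy's estimate is derived from mere complex differentiability.  Goursat's
bisection argument ([goursat_rect]) is applied on a rectangle to the pullback of
[g(x + w) w^(-m)] under [w = e^u]; the [2 pi]-periodicity in [u] turns it into
the independence of [rho] of the [m]-th Fourier coefficient, divided by
[rho^m], of [g] on the circle of radius [rho] about [x].  On a small circle
inside the unit disc [g] is uniformly close to a partial sum of its series, whose
Fourier coefficients are explicit; this spares the re-expansion of the series at
[x]. *)

Local Notation complex_derivable :=
  (ex_derive (K := C_AbsRing) (V := C_NormedModule)).
Local Notation Csum := (sum_n (G := C_AbelianMonoid)).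
Local Notation Rsum := (sum_n (G := R_AbelianMonoid)).

(** * Complex differentiability *)

Lemma Cmod_le_abs (z : C) : Cmod z <= Rabs (Re z) + Rabs (Im z).
Proof.
  destruct z as [x y]; simpl.
  replace (x, y) with (Cplus (RtoC x) (Cmult Ci (RtoC y))).
  2:{ unfold Cplus, Cmult, Ci, RtoC; simpl; f_equal; ring. }
  eapply Rle_trans; [apply Cmod_triangle|].
  rewrite Cmod_mult, Cmod_Ci, !Cmod_R; lra.
Qed.

Lemma im_le_Cmod (z : C) : Rabs (Im z) <= Cmod z.
Proof.
  eapply Rle_trans; [|apply Rmax_Cmod]. apply Rmax_r.
Qed.

(** [C_AbsRing] and [C_NormedModule] carry different uniform structures on [C]; the
estimate in terms of [Cmod] is the form common to both. *)
Lemma complex_derive_eps (g : C -> C) (z : C) :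
  complex_derivable g z ->
  exists l : C, forall eps : R, 0 < eps -> exists delta : R, 0 < delta /\
    forall w : C, Cmod (w - z) < delta ->
      Cmod (g w - g z - l * (w - z)) <= eps * Cmod (w - z).
Proof.
  intros [l [_ Hl]]. exists l. intros eps Heps.
  assert (Hz : is_filter_lim (locally (T := AbsRing_UniformSpace C_AbsRing) z) z)
    by (intros P HP; exact HP).
  destruct (Hl z Hz (mkposreal eps Heps)) as [delta Hd].
  exists delta; split; [apply cond_pos|].
  intros w Hw. specialize (Hd w Hw).
  replace (l * (w - z))%C with ((w - z) * l)%C by ring.
  exact Hd.
Qed.

Lemma complex_derive_of_eps (g : C -> C) (z l : C) :
  (forall eps : R, 0 < eps -> exists delta : R, 0 < delta /\
    forall w : C, Cmod (w - z) < delta ->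
      Cmod (g w - g z - l * (w - z)) <= eps * Cmod (w - z)) ->
  is_derive (K := C_AbsRing) (V := C_NormedModule) g z l.
Proof.
  intros H; split.
  - apply is_linear_scal_l.
  - intros x Hx eps.
    apply (is_filter_lim_locally_unique (K := C_AbsRing)
      (V := AbsRing_NormedModule C_AbsRing)) in Hx. rewrite <- Hx.
    destruct (H eps (cond_pos eps)) as [delta [Hd0 Hd]].
    exists (mkposreal delta Hd0). intros w Hw.
    specialize (Hd w Hw).
    replace (l * (w - z))%C with ((w - z) * l)%C in Hd by ring.
    exact Hd.
Qed.

Lemma complex_derive_lipschitz (g : C -> C) (z : C) :
  complex_derivable g z ->
  exists K delta : R, 0 < delta /\
    forall w : C, Cmod (w - z) < delta -> Cmod (g w - g z) <= K * Cmod (w - z).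
Proof.
  intros H; destruct (complex_derive_eps _ _ H) as [l Hl].
  destruct (Hl 1 Rlt_0_1) as [delta [Hd0 Hd]].
  exists (1 + Cmod l), delta; split; [assumption|].
  intros w Hw.
  replace (g w - g z)%C with ((g w - g z - l * (w - z)) + l * (w - z))%C by ring.
  eapply Rle_trans; [apply Cmod_triangle|].
  rewrite Cmod_mult. specialize (Hd w Hw). lra.
Qed.

(** * Bisection of rectangles *)

(** A common form of the compactness arguments in the plane: a failure would
persist in one quarter at every step, and the nested bad cells would shrink to a
point, where the property holds for all small cells.  Cells are given by their
lower left corner, width and height. *)
Lemma bisection_2d (P : R -> R -> R -> R -> Prop) (x y w h : R) :
  0 <= w -> 0 <= h ->
  (forall x y w h, 0 <= w -> 0 <= h ->
    P x y (w / 2) (h / 2) -> P (x + w / 2) y (w / 2) (h / 2) ->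
    P x (y + h / 2) (w / 2) (h / 2) -> P (x + w / 2) (y + h / 2) (w / 2) (h / 2) ->
    P x y w h) ->
  (forall p q, x <= p <= x + w -> y <= q <= y + h ->
    exists delta, 0 < delta /\ forall x' y' w' h',
      x <= x' -> x' + w' <= x + w -> y <= y' -> y' + h' <= y + h ->
      x' <= p <= x' + w' -> y' <= q <= y' + h' ->
      w' + h' < delta -> P x' y' w' h') ->
  P x y w h.
Proof.
  intros Hw Hh Hsplit Hloc.
  apply NNPP; intros HnP.
  pose (W k := w / 2 ^ k). pose (H k := h / 2 ^ k).
  assert (HW : forall k, 0 <= W k /\ W (S k) = W k / 2).
  { intros k; unfold W; split.
    - apply Rcomplements.Rdiv_le_0_compat; [assumption|apply pow_lt; lra].
    - simpl; field; apply pow_nonzero; lra. }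
  assert (HH : forall k, 0 <= H k /\ H (S k) = H k / 2).
  { intros k; unfold H; split.
    - apply Rcomplements.Rdiv_le_0_compat; [assumption|apply pow_lt; lra].
    - simpl; field; apply pow_nonzero; lra. }
  (* Among the four quarters of a bad cell, the lower left corner of a bad one. *)
  pose (next (w h : R) (c : R * R) :=
    if excluded_middle_informative (~ P (fst c) (snd c) (w / 2) (h / 2)) then c else
    if excluded_middle_informative (~ P (fst c + w / 2) (snd c) (w / 2) (h / 2))
    then (fst c + w / 2, snd c) else
    if excluded_middle_informative (~ P (fst c) (snd c + h / 2) (w / 2) (h / 2))
    then (fst c, snd c + h / 2) else (fst c + w / 2, snd c + h / 2)).
  pose (c := fix c k := match k with O => (x, y) | S k => next (W k) (H k) (c k) end).
  assert (Hc : forall k, ~ P (fst (c k)) (snd (c k)) (W k) (H k)).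
  { induction k as [|k IH].
    - simpl. unfold W, H; simpl. rewrite !Rdiv_1_r. exact HnP.
    - rewrite (proj2 (HW k)), (proj2 (HH k)). change (c (S k)) with (next (W k) (H k) (c k)).
      unfold next.
      destruct excluded_middle_informative as [Hb|H1]; [exact Hb|].
      destruct excluded_middle_informative as [Hb|H2]; [exact Hb|].
      destruct excluded_middle_informative as [Hb|H3]; [exact Hb|].
      simpl. intros H4. apply IH. apply Hsplit; [apply HW|apply HH| | | |exact H4];
        apply NNPP; assumption. }
  assert (Hstep : forall k,
    (fst (c k) <= fst (c (S k)) /\ fst (c (S k)) + W (S k) <= fst (c k) + W k) /\
    (snd (c k) <= snd (c (S k)) /\ snd (c (S k)) + H (S k) <= snd (c k) + H k)).
  { intros k. rewrite (proj2 (HW k)), (proj2 (HH k)).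
    change (c (S k)) with (next (W k) (H k) (c k)).
    destruct (HW k) as [W0 _], (HH k) as [H0 _].
    unfold next.
    destruct excluded_middle_informative; [simpl; lra|].
    destruct excluded_middle_informative; [simpl; lra|].
    destruct excluded_middle_informative; simpl; lra. }
  assert (Hnest : forall j k,
    (fst (c k) <= fst (c (k + j)%nat) /\ fst (c (k + j)%nat) + W (k + j)%nat <= fst (c k) + W k) /\
    (snd (c k) <= snd (c (k + j)%nat) /\ snd (c (k + j)%nat) + H (k + j)%nat <= snd (c k) + H k)).
  { intros j k; induction j as [|j IH].
    - rewrite Nat.add_0_r; lra.
    - rewrite Nat.add_succ_r. specialize (Hstep (k + j)%nat). lra. }
  assert (Hlim : forall (u V : nat -> R),
    (forall k, 0 <= V k) ->
    (forall j k, u k <= u (k + j)%nat /\ u (k + j)%nat + V (k + j)%nat <= u k + V k) ->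
    exists p, forall k, u k <= p <= u k + V k).
  { intros u V HV Hu.
    destruct (completeness (fun t => exists k, t = u k)) as [p [Hp1 Hp2]].
    - exists (u 0%nat + V 0%nat). intros t [k ->].
      specialize (Hu k 0%nat); simpl in Hu; specialize (HV k); lra.
    - exists (u 0%nat), 0%nat; reflexivity.
    - exists p; intros k; split.
      + apply Hp1; exists k; reflexivity.
      + apply Hp2; intros t [j ->].
        destruct (Nat.le_gt_cases k j) as [Hkj|Hjk].
        * replace j with (k + (j - k))%nat by lia.
          specialize (Hu (j - k)%nat k); specialize (HV (k + (j - k))%nat); lra.
        * replace k with (j + (k - j))%nat by lia.
          specialize (Hu (k - j)%nat j); specialize (HV (j + (k - j))%nat); lra. }
  destruct (Hlim (fun k => fst (c k)) W) as [p Hp].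
  { intros k; apply HW. } { intros j k; apply Hnest. }
  destruct (Hlim (fun k => snd (c k)) H) as [q Hq].
  { intros k; apply HH. } { intros j k; apply Hnest. }
  assert (W0 : W 0%nat = w) by (unfold W; simpl; lra).
  assert (H0 : H 0%nat = h) by (unfold H; simpl; lra).
  destruct (Hloc p q) as [delta [Hd0 Hd]].
  { specialize (Hp 0%nat); rewrite W0 in Hp; exact Hp. }
  { specialize (Hq 0%nat); rewrite H0 in Hq; exact Hq. }
  assert (Hsmall : exists k, W k + H k < delta).
  { destruct (pow_lt_1_zero (1 / 2)) with (y := delta / (w + h + 1)) as [k Hk].
    - rewrite Rabs_pos_eq; lra.
    - apply Rdiv_lt_0_compat; lra.
    - exists k. specialize (Hk k (Nat.le_refl _)).
      rewrite Rabs_pos_eq in Hk by (apply pow_le; lra).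
      replace (W k + H k) with ((w + h) * (1 / 2) ^ k).
      2:{ unfold W, H, Rdiv. rewrite Rmult_1_l, pow_inv; ring. }
      assert (0 < (1 / 2) ^ k) by (apply pow_lt; lra).
      apply (Rmult_lt_compat_r (w + h + 1)) in Hk; [|lra].
      unfold Rdiv at 2 in Hk. rewrite Rmult_assoc, Rinv_l in Hk by lra. nra. }
  destruct Hsmall as [k Hk].
  apply (Hc k). specialize (Hnest k 0%nat). simpl in Hnest. rewrite W0, H0 in Hnest.
  apply Hd; try assumption; try (apply Hp); try (apply Hq); lra.
Qed.

(** * Goursat's theorem for rectangles *)

(** The integral along a real interval is taken componentwise, so that linearity
over [C] reduces to linearity of the real integral. *)
Definition CInt (f : R -> C) (a b : R) : C :=
  (RInt (fun t => Re (f t)) a b, RInt (fun t => Im (f t)) a b).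

Definition ex_CInt (f : R -> C) (a b : R) : Prop :=
  ex_RInt (fun t => Re (f t)) a b /\ ex_RInt (fun t => Im (f t)) a b.

Lemma ex_CInt_plus (f g : R -> C) (a b : R) :
  ex_CInt f a b -> ex_CInt g a b -> ex_CInt (fun t => f t + g t)%C a b.
Proof.
  intros [Hf1 Hf2] [Hg1 Hg2]; split.
  - exact (ex_RInt_plus _ _ a b Hf1 Hg1).
  - exact (ex_RInt_plus _ _ a b Hf2 Hg2).
Qed.

Lemma CInt_plus (f g : R -> C) (a b : R) :
  ex_CInt f a b -> ex_CInt g a b ->
  CInt (fun t => f t + g t)%C a b = (CInt f a b + CInt g a b)%C.
Proof.
  intros [Hf1 Hf2] [Hg1 Hg2]; unfold CInt, Cplus; simpl; f_equal.
  - exact (RInt_plus _ _ a b Hf1 Hg1).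
  - exact (RInt_plus _ _ a b Hf2 Hg2).
Qed.

Lemma ex_CInt_scal (c : C) (f : R -> C) (a b : R) :
  ex_CInt f a b -> ex_CInt (fun t => c * f t)%C a b.
Proof.
  intros [Hf1 Hf2]; split.
  - exact (ex_RInt_minus _ _ a b (ex_RInt_scal _ a b (fst c) Hf1)
                                  (ex_RInt_scal _ a b (snd c) Hf2)).
  - exact (ex_RInt_plus _ _ a b (ex_RInt_scal _ a b (fst c) Hf2)
                                 (ex_RInt_scal _ a b (snd c) Hf1)).
Qed.

Lemma CInt_scal (c : C) (f : R -> C) (a b : R) :
  ex_CInt f a b -> CInt (fun t => c * f t)%C a b = (c * CInt f a b)%C.
Proof.
  intros [Hf1 Hf2]; unfold CInt, Cmult; simpl; f_equal.
  - rewrite <- (RInt_scal _ a b (fst c) Hf1 : _ = fst c * _).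
    rewrite <- (RInt_scal _ a b (snd c) Hf2 : _ = snd c * _).
    exact (RInt_minus _ _ a b (ex_RInt_scal _ a b (fst c) Hf1)
                              (ex_RInt_scal _ a b (snd c) Hf2)).
  - rewrite <- (RInt_scal _ a b (fst c) Hf2 : _ = fst c * _).
    rewrite <- (RInt_scal _ a b (snd c) Hf1 : _ = snd c * _).
    exact (RInt_plus _ _ a b (ex_RInt_scal _ a b (fst c) Hf2)
                             (ex_RInt_scal _ a b (snd c) Hf1)).
Qed.

Lemma ex_CInt_minus (f g : R -> C) (a b : R) :
  ex_CInt f a b -> ex_CInt g a b -> ex_CInt (fun t => f t - g t)%C a b.
Proof.
  intros [Hf1 Hf2] [Hg1 Hg2]; split.
  - exact (ex_RInt_minus _ _ a b Hf1 Hg1).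
  - exact (ex_RInt_minus _ _ a b Hf2 Hg2).
Qed.

Lemma CInt_minus (f g : R -> C) (a b : R) :
  ex_CInt f a b -> ex_CInt g a b ->
  CInt (fun t => f t - g t)%C a b = (CInt f a b - CInt g a b)%C.
Proof.
  intros [Hf1 Hf2] [Hg1 Hg2]; unfold CInt, Cminus, Cplus, Copp; simpl; f_equal.
  - exact (RInt_minus _ _ a b Hf1 Hg1).
  - exact (RInt_minus _ _ a b Hf2 Hg2).
Qed.

Lemma CInt_Chasles (f : R -> C) (a b c : R) :
  ex_CInt f a b -> ex_CInt f b c -> (CInt f a b + CInt f b c)%C = CInt f a c.
Proof.
  intros [Hf1 Hf2] [Hg1 Hg2]; unfold CInt, Cplus; simpl; f_equal.
  - exact (RInt_Chasles _ a b c Hf1 Hg1).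
  - exact (RInt_Chasles _ a b c Hf2 Hg2).
Qed.

Lemma CInt_ext (f g : R -> C) (a b : R) :
  (forall t, f t = g t) -> CInt f a b = CInt g a b.
Proof.
  intros H; unfold CInt; f_equal; apply RInt_ext; intros t _; rewrite H; reflexivity.
Qed.

Lemma ex_CInt_ext (f g : R -> C) (a b : R) :
  (forall t, f t = g t) -> ex_CInt f a b -> ex_CInt g a b.
Proof.
  intros H [H1 H2]; split.
  - apply (ex_RInt_ext (fun t => Re (f t))); [intros t _; rewrite H|]; auto.
  - apply (ex_RInt_ext (fun t => Im (f t))); [intros t _; rewrite H|]; auto.
Qed.

Lemma Cmod_CInt_le (f : R -> C) (a b M : R) :
  a <= b -> ex_CInt f a b -> (forall t, a <= t <= b -> Cmod (f t) <= M) ->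
  Cmod (CInt f a b) <= (b - a) * M.
Proof.
  intros Hab [H1 H2] HM.
  assert (HI : is_RInt (V := C_R_NormedModule) f a b (CInt f a b)).
  { apply (is_RInt_fct_extend_pair (U := R_NormedModule) (V := R_NormedModule)).
    - exact (RInt_correct _ a b H1).
    - exact (RInt_correct _ a b H2). }
  assert (Hn : forall z : C, norm (V := C_R_NormedModule) z = Cmod z).
  { intros [u v]. unfold norm; simpl. unfold prod_norm, Cmod; simpl.
    unfold norm; simpl. unfold abs; simpl. f_equal.
    generalize (Rsqr_abs u) (Rsqr_abs v); unfold Rsqr; intros E1 E2.
    rewrite !Rmult_1_r; f_equal; symmetry; assumption. }
  rewrite <- Hn. apply (norm_RInt_le_const f a b _ M Hab); [|exact HI].
  intros t Ht; rewrite Hn; auto.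
Qed.

Lemma is_RInt_affine (p q a b : R) :
  is_RInt (fun t => p + t * q) a b ((b - a) * p + (b * b - a * a) / 2 * q).
Proof.
  replace ((b - a) * p + (b * b - a * a) / 2 * q)
    with (minus (b * p + b * b / 2 * q) (a * p + a * a / 2 * q))
    by (unfold minus, plus, opp; simpl; field).
  apply (is_RInt_derive (fun t => t * p + t * t / 2 * q)).
  - intros t _. auto_derive; [trivial|field].
  - intros t _. apply (continuous_plus (V := R_NormedModule)).
    + apply continuous_const.
    + apply (continuous_mult (K := R_AbsRing)); [apply continuous_id|apply continuous_const].
Qed.

Lemma is_CInt_affine (A B : C) (a b : R) :
  ex_CInt (fun t => A + t * B)%C a b /\
  CInt (fun t => A + t * B)%C a b
  = ((b - a)%R * A + ((b * b - a * a) / 2)%R * B)%C.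
Proof.
  assert (H1 : is_RInt (fun t : R => Re (A + t * B)%C) a b
                 ((b - a) * Re A + (b * b - a * a) / 2 * Re B)).
  { eapply is_RInt_ext; [|apply is_RInt_affine].
    intros t _; unfold Re; simpl; ring. }
  assert (H2 : is_RInt (fun t : R => Im (A + t * B)%C) a b
                 ((b - a) * Im A + (b * b - a * a) / 2 * Im B)).
  { eapply is_RInt_ext; [|apply is_RInt_affine].
    intros t _; unfold Im; simpl; ring. }
  split.
  - split; eexists; eassumption.
  - unfold CInt. rewrite (is_RInt_unique _ _ _ _ H1), (is_RInt_unique _ _ _ _ H2).
    unfold Cplus, Cmult, RtoC, Re, Im; simpl; f_equal; ring.
Qed.

Lemma continuous_of_lipschitz (f : R -> R) (x K delta : R) :
  0 < delta -> (forall t, Rabs (t - x) < delta -> Rabs (f t - f x) <= K * Rabs (t - x)) ->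
  continuous f x.
Proof.
  intros Hd HK. apply filterlim_locally. intros eps.
  assert (Hm : 0 < Rmin delta (eps / (Rabs K + 1))).
  { apply Rmin_pos; [assumption|].
    apply Rdiv_lt_0_compat; [apply cond_pos|generalize (Rabs_pos K); lra]. }
  exists (mkposreal _ Hm). intros t Ht.
  change (Rabs (t - x) < Rmin delta (eps / (Rabs K + 1))) in Ht.
  change (Rabs (f t - f x) < eps).
  eapply Rle_lt_trans; [apply HK|].
  - eapply Rlt_le_trans; [exact Ht|apply Rmin_l].
  - assert (HKp := Rabs_pos K).
    assert (Ht' : Rabs (t - x) < eps / (Rabs K + 1))
      by (eapply Rlt_le_trans; [exact Ht|apply Rmin_r]).
    apply (Rmult_lt_compat_r (Rabs K + 1)) in Ht'; [|lra].
    unfold Rdiv in Ht'. rewrite Rmult_assoc, Rinv_l in Ht' by lra.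
    assert (Hle := Rle_abs K). assert (Htp := Rabs_pos (t - x)). nra.
Qed.

Lemma ex_CInt_of_lipschitz (f : R -> C) (a b : R) : a <= b ->
  (forall t, a <= t <= b -> exists K delta, 0 < delta /\
    forall t', Rabs (t' - t) < delta -> Cmod (f t' - f t) <= K * Rabs (t' - t)) ->
  ex_CInt f a b.
Proof.
  intros Hab H.
  split; apply (ex_RInt_continuous (V := R_CompleteNormedModule));
    rewrite (Rmin_left a b), (Rmax_right a b) by assumption; intros t Ht;
    destruct (H t Ht) as [K [delta [Hd HK]]];
    apply (continuous_of_lipschitz _ t K delta Hd); intros t' Ht';
    (eapply Rle_trans; [|apply HK; exact Ht']).
  - eapply Rle_trans; [|apply re_le_Cmod]. apply Req_le; reflexivity.
  - eapply Rle_trans; [|apply im_le_Cmod]. apply Req_le; reflexivity.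
Qed.

Lemma ex_CInt_horizontal (F : C -> C) (a b v : R) : a <= b ->
  (forall t, a <= t <= b -> complex_derivable F (t, v)) ->
  ex_CInt (fun t => F (t, v)) a b.
Proof.
  intros Hab H; apply ex_CInt_of_lipschitz; [assumption|intros t Ht].
  destruct (complex_derive_lipschitz _ _ (H t Ht)) as [K [delta [Hd HK]]].
  exists K, delta; split; [assumption|]; intros t' Ht'.
  assert (E : Cmod ((t', v) - (t, v))%C = Rabs (t' - t)).
  { replace ((t', v) - (t, v))%C with (RtoC (t' - t)); [apply Cmod_R|].
    unfold RtoC, Cminus, Cplus, Copp; simpl; f_equal; ring. }
  rewrite <- E; apply HK; rewrite E; exact Ht'.
Qed.

Lemma ex_CInt_vertical (F : C -> C) (a b u : R) : a <= b ->
  (forall t, a <= t <= b -> complex_derivable F (u, t)) ->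
  ex_CInt (fun t => F (u, t)) a b.
Proof.
  intros Hab H; apply ex_CInt_of_lipschitz; [assumption|intros t Ht].
  destruct (complex_derive_lipschitz _ _ (H t Ht)) as [K [delta [Hd HK]]].
  exists K, delta; split; [assumption|]; intros t' Ht'.
  assert (E : Cmod ((u, t') - (u, t))%C = Rabs (t' - t)).
  { replace ((u, t') - (u, t))%C with (Ci * RtoC (t' - t))%C.
    - rewrite Cmod_mult, Cmod_Ci, Rmult_1_l; apply Cmod_R.
    - unfold RtoC, Ci, Cmult, Cminus, Cplus, Copp; simpl; f_equal; ring. }
  rewrite <- E; apply HK; rewrite E; exact Ht'.
Qed.

(** The contour integral along the boundary of the rectangle, counterclockwise. *)
Definition rect_integral (F : C -> C) (x y w h : R) : C :=
  (CInt (fun t => F (t, y)) x (x + w) - CInt (fun t => F (t, (y + h)%R)) x (x + w)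
   + Ci * (CInt (fun t => F ((x + w)%R, t)) y (y + h) - CInt (fun t => F (x, t)) y (y + h)))%C.

Definition derivable_on_rect (F : C -> C) (x y w h : R) : Prop :=
  forall u v, x <= u <= x + w -> y <= v <= y + h ->
    complex_derivable F (u, v).

Lemma rect_integral_split (F : C -> C) (x y w h : R) : 0 <= w -> 0 <= h ->
  derivable_on_rect F x y w h ->
  rect_integral F x y w h =
  (rect_integral F x y (w / 2) (h / 2) + rect_integral F (x + w / 2) y (w / 2) (h / 2)
   + rect_integral F x (y + h / 2) (w / 2) (h / 2)
   + rect_integral F (x + w / 2) (y + h / 2) (w / 2) (h / 2))%C.
Proof.
  intros Hw Hh HF. unfold rect_integral.
  replace (x + w / 2 + w / 2) with (x + w) by field.
  replace (y + h / 2 + h / 2) with (y + h) by field.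
  assert (HH : forall v, y <= v <= y + h ->
    CInt (fun t => F (t, v)) x (x + w)
    = (CInt (fun t => F (t, v)) x (x + w / 2)
       + CInt (fun t => F (t, v)) (x + w / 2) (x + w))%C).
  { intros v Hv. symmetry; apply CInt_Chasles; apply ex_CInt_horizontal; try lra;
      intros t Ht; apply HF; lra. }
  assert (HV : forall u, x <= u <= x + w ->
    CInt (fun t => F (u, t)) y (y + h)
    = (CInt (fun t => F (u, t)) y (y + h / 2)
       + CInt (fun t => F (u, t)) (y + h / 2) (y + h))%C).
  { intros v Hv. symmetry; apply CInt_Chasles; apply ex_CInt_vertical; try lra;
      intros t Ht; apply HF; lra. }
  rewrite (HH y), (HH (y + h)), (HV x), (HV (x + w)) by lra. ring.
Qed.

(** Affine functions have an antiderivative; here the four sides are simply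
computed. *)
Lemma rect_integral_affine (A B z0 : C) (x y w h : R) :
  rect_integral (fun z => A + B * (z - z0))%C x y w h = 0.
Proof.
  unfold rect_integral.
  assert (HH : forall v a b, CInt (fun t => A + B * ((t, v) - z0))%C a b
    = ((b - a)%R * (A + B * ((0, v) - z0)) + ((b * b - a * a) / 2)%R * B)%C).
  { intros v a b. rewrite <- (proj2 (is_CInt_affine _ _ _ _)). apply CInt_ext; intros t.
    replace (t, v) with (RtoC t + (0, v))%C; [ring|].
    unfold RtoC, Cplus; simpl; f_equal; ring. }
  assert (HV : forall u a b, CInt (fun t => A + B * ((u, t) - z0))%C a b
    = ((b - a)%R * (A + B * (RtoC u - z0)) + ((b * b - a * a) / 2)%R * (B * Ci))%C).
  { intros u a b. rewrite <- (proj2 (is_CInt_affine _ _ _ _)). apply CInt_ext; intros t.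
    replace (u, t) with (RtoC u + Ci * RtoC t)%C; [ring|].
    unfold RtoC, Ci, Cmult, Cplus; simpl; f_equal; ring. }
  rewrite !HH, !HV. destruct A as [A1 A2], B as [B1 B2], z0 as [z1 z2].
  unfold RtoC, Ci, Cmult, Cminus, Cplus, Copp; simpl. f_equal; field.
Qed.

(** Goursat's argument: near a point [F] is affine up to an error [e |z - p|], so
a small rectangle contributes at most [e (w + h)] times its perimeter.  This
quadratic bound is stable under cutting into four, hence holds for the given
rectangle, with [e] arbitrary. *)
Lemma goursat_rect (F : C -> C) (x y w h : R) : 0 <= w -> 0 <= h ->
  derivable_on_rect F x y w h -> rect_integral F x y w h = 0.
Proof.
  intros Hw Hh HF. apply Cmod_eq_0.
  apply Rle_antisym; [|apply Cmod_ge_0].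
  apply le_epsilon. intros eps Heps. rewrite Rplus_0_l.
  pose (e := eps / (2 * (w + h + 1) * (w + h + 1))).
  assert (He : 0 < e) by (apply Rdiv_lt_0_compat; nra).
  assert (Hmain : derivable_on_rect F x y w h ->
                  Cmod (rect_integral F x y w h) <= 2 * e * (w + h) * (w + h)).
  2:{ eapply Rle_trans; [apply Hmain; exact HF|].
      replace eps with (2 * e * (w + h + 1) * (w + h + 1)) by (unfold e; field; lra).
      assert (0 <= 2 * e) by lra.
      rewrite !Rmult_assoc. apply Rmult_le_compat_l; [lra|].
      apply Rmult_le_compat_l; nra. }
  clearbody e; clear eps Heps.
  apply (bisection_2d (fun x y w h => derivable_on_rect F x y w h ->
    Cmod (rect_integral F x y w h) <= 2 * e * (w + h) * (w + h))); try assumption.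
  - clear x y w h Hw Hh HF. intros x y w h Hw Hh H1 H2 H3 H4 HF.
    rewrite rect_integral_split by assumption.
    assert (K1 := H1 ltac:(intros u v Hu Hv; apply HF; lra)).
    assert (K2 := H2 ltac:(intros u v Hu Hv; apply HF; lra)).
    assert (K3 := H3 ltac:(intros u v Hu Hv; apply HF; lra)).
    assert (K4 := H4 ltac:(intros u v Hu Hv; apply HF; lra)).
    eapply Rle_trans; [apply Cmod_triangle|].
    eapply Rle_trans; [apply Rplus_le_compat_r, Cmod_triangle|].
    eapply Rle_trans; [apply Rplus_le_compat_r, Rplus_le_compat_r, Cmod_triangle|].
    replace (w / 2 + h / 2) with ((w + h) / 2) in * by field. lra.
  - intros p q Hp Hq.
    destruct (complex_derive_eps _ _ (HF p q Hp Hq)) as [l Hl].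
    destruct (Hl e He) as [delta [Hd0 Hd]].
    exists delta; split; [assumption|].
    intros x' y' w' h' H1 H2 H3 H4 Hp' Hq' Hsm HF'.
    pose (A z := (F (p, q) + l * (z - (p, q)))%C).
    pose (E z := (F z - A z)%C).
    assert (HE : forall u v, x' <= u <= x' + w' -> y' <= v <= y' + h' ->
                 Cmod (E (u, v)) <= e * (w' + h')).
    { intros u v Hu Hv.
      assert (Huv : Cmod ((u, v) - (p, q))%C <= w' + h').
      { eapply Rle_trans; [apply Cmod_le_abs|]. unfold Re, Im; simpl.
        apply Rplus_le_compat; apply Rabs_le; lra. }
      unfold E, A.
      replace (F (u, v) - (F (p, q) + l * ((u, v) - (p, q))))%C
        with (F (u, v) - F (p, q) - l * ((u, v) - (p, q)))%C by ring.
      eapply Rle_trans; [apply Hd; lra|]. nra. }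
    assert (HexA : forall a b v, ex_CInt (fun t => A (t, v)) a b).
    { intros a b v. apply (ex_CInt_ext (fun t => (F (p, q) + l * ((0, v) - (p, q))) + t * l)%C).
      - intros t; unfold A. replace (t, v) with (RtoC t + (0, v))%C; [ring|].
        unfold RtoC, Cplus; simpl; f_equal; ring.
      - apply is_CInt_affine. }
    assert (HexA' : forall a b u, ex_CInt (fun t => A (u, t)) a b).
    { intros a b u.
      apply (ex_CInt_ext (fun t => (F (p, q) + l * (RtoC u - (p, q))) + t * (l * Ci))%C).
      - intros t; unfold A. replace (u, t) with (RtoC u + Ci * RtoC t)%C; [ring|].
        unfold RtoC, Ci, Cmult, Cplus; simpl; f_equal; ring.
      - apply is_CInt_affine. }
    assert (HexF : forall v, y' <= v <= y' + h' -> ex_CInt (fun t => F (t, v)) x' (x' + w')).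
    { intros v Hv; apply ex_CInt_horizontal; [lra|]; intros t Ht; apply HF'; lra. }
    assert (HexF' : forall u, x' <= u <= x' + w' -> ex_CInt (fun t => F (u, t)) y' (y' + h')).
    { intros u Hu; apply ex_CInt_vertical; [lra|]; intros t Ht; apply HF'; lra. }
    assert (HFE : rect_integral F x' y' w' h' = rect_integral E x' y' w' h').
    { replace (rect_integral E x' y' w' h')
        with (rect_integral F x' y' w' h' - rect_integral A x' y' w' h')%C.
      - unfold A; rewrite rect_integral_affine; ring.
      - unfold rect_integral, E.
        rewrite (CInt_minus (fun t => F (t, y')) (fun t => A (t, y')) _ _ (HexF y' ltac:(lra)) (HexA _ _ _)),
          (CInt_minus (fun t => F (t, (y' + h')%R)) (fun t => A (t, (y' + h')%R)) _ _
            (HexF (y' + h') ltac:(lra)) (HexA _ _ _)),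
          (CInt_minus (fun t => F (x', t)) (fun t => A (x', t)) _ _
            (HexF' x' ltac:(lra)) (HexA' _ _ _)),
          (CInt_minus (fun t => F ((x' + w')%R, t)) (fun t => A ((x' + w')%R, t)) _ _
            (HexF' (x' + w') ltac:(lra)) (HexA' _ _ _)).
        ring. }
    rewrite HFE. unfold rect_integral.
    assert (HB : forall v, y' <= v <= y' + h' ->
       Cmod (CInt (fun t => E (t, v)) x' (x' + w')) <= w' * (e * (w' + h'))).
    { intros v Hv. replace w' with (x' + w' - x') at 2 by ring.
      apply Cmod_CInt_le; [lra| |].
      - exact (ex_CInt_minus _ _ _ _ (HexF v Hv) (HexA _ _ _)).
      - intros t Ht; apply HE; lra. }
    assert (HB' : forall u, x' <= u <= x' + w' ->
       Cmod (CInt (fun t => E (u, t)) y' (y' + h')) <= h' * (e * (w' + h'))).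
    { intros u Hu. replace h' with (y' + h' - y') at 2 by ring.
      apply Cmod_CInt_le; [lra| |].
      - exact (ex_CInt_minus _ _ _ _ (HexF' u Hu) (HexA' _ _ _)).
      - intros t Ht; apply HE; lra. }
    assert (K1 := HB y' ltac:(lra)). assert (K2 := HB (y' + h') ltac:(lra)).
    assert (K3 := HB' x' ltac:(lra)). assert (K4 := HB' (x' + w') ltac:(lra)).
    eapply Rle_trans; [apply Cmod_triangle|].
    rewrite Cmod_mult, Cmod_Ci, Rmult_1_l.
    eapply Rle_trans; [apply Rplus_le_compat; apply Cmod_triangle|].
    rewrite !Cmod_opp. nra.
Qed.

(** * Fourier coefficients on circles *)

Definition cis (t : R) : C := (cos t, sin t).

Definition Cexp (u : C) : C := (RtoC (exp (Re u)) * cis (Im u))%C.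

Lemma Cmod_cis (t : R) : Cmod (cis t) = 1.
Proof.
  unfold cis, Cmod; simpl. rewrite !Rmult_1_r.
  replace (cos t * cos t + sin t * sin t) with 1; [apply sqrt_1|].
  generalize (sin2_cos2 t); unfold Rsqr; lra.
Qed.

Lemma cis_0 : cis 0 = 1.
Proof. unfold cis; rewrite cos_0, sin_0; reflexivity. Qed.

Lemma cis_plus (s t : R) : cis (s + t) = (cis s * cis t)%C.
Proof.
  unfold cis, Cmult; simpl; rewrite cos_plus, sin_plus; f_equal; ring.
Qed.

Lemma cis_pow (t : R) (n : nat) : (cis t ^ n)%C = cis (INR n * t).
Proof.
  induction n as [|n IH].
  - simpl. rewrite Rmult_0_l, cis_0; reflexivity.
  - rewrite Cpow_S, IH, <- cis_plus, S_INR; f_equal; ring.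
Qed.

Lemma cis_INR_2PI (n : nat) : cis (INR n * (2 * PI)) = 1.
Proof.
  rewrite <- cis_pow.
  replace (cis (2 * PI)) with (RtoC 1); [apply Cpow_1_l|].
  unfold cis; rewrite cos_2PI, sin_2PI; reflexivity.
Qed.

Lemma Cexp_plus (u v : C) : Cexp (u + v) = (Cexp u * Cexp v)%C.
Proof.
  unfold Cexp. rewrite re_plus, im_plus, exp_plus, cis_plus, RtoC_mult; ring.
Qed.

Lemma derivable_pt_lim_0_eps (f : R -> R) (l eps : R) : derivable_pt_lim f 0 l -> 0 < eps ->
  exists delta, 0 < delta /\
    forall t, Rabs t < delta -> Rabs (f t - f 0 - l * t) <= eps * Rabs t.
Proof.
  intros H He. destruct (H eps He) as [delta Hd].
  exists delta; split; [apply cond_pos|]. intros t Ht.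
  destruct (Req_dec t 0) as [->|Hn].
  - replace (f 0 - f 0 - l * 0) with 0 by ring. rewrite Rabs_R0; lra.
  - specialize (Hd t Hn Ht). rewrite Rplus_0_l in Hd.
    replace (f t - f 0 - l * t) with (((f t - f 0) / t - l) * t) by (field; assumption).
    rewrite Rabs_mult. apply Rmult_le_compat_r; [apply Rabs_pos|lra].
Qed.

Lemma is_derive_Cexp_0 (eps : R) : 0 < eps -> exists delta, 0 < delta /\
  forall h : C, Cmod h < delta -> Cmod (Cexp h - 1 - h) <= eps * Cmod h.
Proof.
  intros Heps. pose (e := Rmin (eps / 7) (1 / 2)).
  assert (He : 0 < e) by (apply Rmin_pos; lra).
  assert (He1 : e <= eps / 7) by apply Rmin_l.
  assert (He2 : e <= 1 / 2) by apply Rmin_r.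
  clearbody e.
  assert (D1 := derivable_pt_lim_exp 0). rewrite exp_0 in D1.
  assert (D2 := derivable_pt_lim_sin 0). rewrite cos_0 in D2.
  assert (D3 := derivable_pt_lim_cos 0). rewrite sin_0, Ropp_0 in D3.
  destruct (derivable_pt_lim_0_eps _ _ e D1 He) as [d1 [Hd1 H1]].
  destruct (derivable_pt_lim_0_eps _ _ e D2 He) as [d2 [Hd2 H2]].
  destruct (derivable_pt_lim_0_eps _ _ e D3 He) as [d3 [Hd3 H3]].
  rewrite exp_0 in H1. rewrite sin_0 in H2. rewrite cos_0 in H3.
  exists (Rmin e (Rmin d1 (Rmin d2 d3))); split.
  { repeat apply Rmin_pos; assumption. }
  intros h Hh.
  assert (Hh0 : Cmod h < e) by (eapply Rlt_le_trans; [exact Hh|apply Rmin_l]).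
  assert (Hh' : Cmod h < Rmin d1 (Rmin d2 d3)) by (eapply Rlt_le_trans; [exact Hh|apply Rmin_r]).
  assert (Hh1 : Cmod h < d1) by (eapply Rlt_le_trans; [exact Hh'|apply Rmin_l]).
  assert (Hh'' : Cmod h < Rmin d2 d3) by (eapply Rlt_le_trans; [exact Hh'|apply Rmin_r]).
  assert (Hh2 : Cmod h < d2) by (eapply Rlt_le_trans; [exact Hh''|apply Rmin_l]).
  assert (Hh3 : Cmod h < d3) by (eapply Rlt_le_trans; [exact Hh''|apply Rmin_r]).
  assert (Ra := re_le_Cmod h). assert (Rb := im_le_Cmod h).
  specialize (H1 (Re h) ltac:(lra)). specialize (H2 (Im h) ltac:(lra)).
  specialize (H3 (Im h) ltac:(lra)).
  set (a := Re h) in *. set (b := Im h) in *. set (H := Cmod h) in *.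
  pose (al := exp a - 1 - 1 * a). pose (si := sin b - 0 - 1 * b). pose (ga := cos b - 1 - 0 * b).
  fold al in H1; fold si in H2; fold ga in H3.
  assert (Ea : exp a = 1 + a + al) by (unfold al; ring).
  assert (P1 := Rabs_pos a). assert (P2 := Rabs_pos b).
  assert (Bal : Rabs al <= e * H) by nra.
  assert (Bsi : Rabs si <= e * H) by nra.
  assert (Bga : Rabs ga <= e * H) by nra.
  assert (Bexp : Rabs (exp a) <= 2).
  { rewrite Ea. eapply Rle_trans; [apply Rabs_triang|].
    eapply Rle_trans; [apply Rplus_le_compat_r, Rabs_triang|]. rewrite Rabs_R1. nra. }
  assert (Baal : Rabs (a + al) <= 2 * e).
  { eapply Rle_trans; [apply Rabs_triang|]. nra. }
  assert (PH : 0 <= H) by apply Cmod_ge_0.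
  eapply Rle_trans; [apply Cmod_le_abs|].
  replace (Re (Cexp h - 1 - h)) with (exp a * ga + al).
  2:{ unfold ga, al, a, b, Cexp, cis, Re, Im; simpl; ring. }
  replace (Im (Cexp h - 1 - h)) with (exp a * si + (a + al) * b).
  2:{ unfold si, al, a, b, Cexp, cis, Re, Im; simpl; ring. }
  assert (T1 := Rabs_triang (exp a * ga) al). assert (T2 := Rabs_triang (exp a * si) ((a + al) * b)).
  rewrite !Rabs_mult in T1. rewrite !(Rabs_mult (exp a)), (Rabs_mult (a + al)) in T2.
  assert (Pg := Rabs_pos ga). assert (Ps := Rabs_pos si).
  assert (Pal := Rabs_pos (a + al)). assert (Pe := Rabs_pos (exp a)).
  assert (Q1 : Rabs (exp a) * Rabs ga <= 2 * (e * H)) by (apply Rmult_le_compat; lra).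
  assert (Q2 : Rabs (exp a) * Rabs si <= 2 * (e * H)) by (apply Rmult_le_compat; lra).
  assert (Q3 : Rabs (a + al) * Rabs b <= 2 * e * H) by (apply Rmult_le_compat; lra).
  assert (Q4 : 7 * e * H <= eps * H) by (apply Rmult_le_compat_r; lra).
  lra.
Qed.

Lemma is_derive_Cexp (u : C) :
  is_derive (K := C_AbsRing) (V := C_NormedModule) Cexp u (Cexp u).
Proof.
  apply complex_derive_of_eps. intros eps Heps.
  destruct (is_derive_Cexp_0 (eps / (Cmod (Cexp u) + 1))) as [delta [Hd0 Hd]].
  { apply Rdiv_lt_0_compat; [assumption|generalize (Cmod_ge_0 (Cexp u)); lra]. }
  exists delta; split; [assumption|]. intros w Hw. specialize (Hd _ Hw).
  replace (Cexp w) with (Cexp u * Cexp (w - u))%C.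
  2:{ rewrite <- Cexp_plus; f_equal; ring. }
  replace (Cexp u * Cexp (w - u) - Cexp u - Cexp u * (w - u))%C
    with (Cexp u * (Cexp (w - u) - 1 - (w - u)))%C by ring.
  rewrite Cmod_mult. assert (HE := Cmod_ge_0 (Cexp u)).
  eapply Rle_trans; [apply Rmult_le_compat_l; [exact HE|exact Hd]|].
  rewrite <- Rmult_assoc. apply Rmult_le_compat_r; [apply Cmod_ge_0|].
  apply (Rmult_le_reg_r (Cmod (Cexp u) + 1)); [lra|].
  replace (Cmod (Cexp u) * (eps / (Cmod (Cexp u) + 1)) * (Cmod (Cexp u) + 1))
    with (Cmod (Cexp u) * eps) by (field; lra). nra.
Qed.

Lemma ex_derive_affine (A B z : C) :
  complex_derivable (fun u => A + B * u)%C z.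
Proof.
  exists B. apply complex_derive_of_eps. intros eps Heps.
  exists 1; split; [lra|]. intros w _.
  replace (A + B * w - (A + B * z) - B * (w - z))%C with (RtoC 0) by ring.
  rewrite Cmod_0. generalize (Cmod_ge_0 (w - z)); nra.
Qed.

(** In the general chain rule the inner function takes its values in
[AbsRing_NormedModule C_AbsRing], whose norm is that of [C_NormedModule] although
its uniform structure is another one. *)
Lemma ex_derive_Ccomp (f g : C -> C) (z : C) :
  complex_derivable f (g z) ->
  complex_derivable g z ->
  complex_derivable (fun u => f (g u)) z.
Proof.
  intros Hf [l Hg].
  apply (ex_derive_comp (K := C_AbsRing) (V := C_NormedModule) f g z Hf).
  exists l. destruct Hg as [_ Hg]. split; [apply is_linear_scal_l|exact Hg].
Qed.

Lemma ex_derive_Cmult (f g : C -> C) (z : C) :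
  complex_derivable f z ->
  complex_derivable g z ->
  complex_derivable (fun u => f u * g u)%C z.
Proof.
  intros Hf Hg.
  destruct (complex_derive_lipschitz _ _ Hg) as [K [d0 [Hd0 HK]]].
  destruct (complex_derive_eps _ _ Hf) as [lf Hlf].
  destruct (complex_derive_eps _ _ Hg) as [lg Hlg].
  exists (lf * g z + f z * lg)%C. apply complex_derive_of_eps. intros eps Heps.
  pose (A := Cmod (f z) + Cmod (g z) + Rabs K + Cmod lf + 1).
  assert (P1 := Cmod_ge_0 (f z)). assert (P2 := Cmod_ge_0 (g z)).
  assert (P3 := Cmod_ge_0 lf). assert (P4 := Rabs_pos K). assert (P5 := Rle_abs K).
  pose (e := Rmin 1 (eps / (4 * A * A))).
  assert (HA : 1 <= A) by (unfold A; lra).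
  assert (He : 0 < e) by (apply Rmin_pos; [lra|apply Rdiv_lt_0_compat; nra]).
  assert (HeA : 4 * A * A * e <= eps).
  { apply Rle_trans with (4 * A * A * (eps / (4 * A * A))).
    - apply Rmult_le_compat_l; [nra|apply Rmin_r].
    - apply Req_le; field; lra. }
  assert (He1 : e <= 1) by apply Rmin_l.
  clearbody e.
  destruct (Hlf e He) as [d1 [Hd1 H1]]. destruct (Hlg e He) as [d2 [Hd2 H2]].
  exists (Rmin (Rmin d0 e) (Rmin d1 d2)); split; [repeat apply Rmin_pos; assumption|].
  intros w Hw.
  assert (M1 := Rmin_l (Rmin d0 e) (Rmin d1 d2)). assert (M2 := Rmin_r (Rmin d0 e) (Rmin d1 d2)).
  assert (M3 := Rmin_l d0 e). assert (M4 := Rmin_r d0 e).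
  assert (M5 := Rmin_l d1 d2). assert (M6 := Rmin_r d1 d2).
  specialize (H1 w ltac:(lra)). specialize (H2 w ltac:(lra)). specialize (HK w ltac:(lra)).
  assert (Hwe : Cmod (w - z) <= e) by lra.
  set (d := (w - z)%C) in *.
  replace (f w * g w - f z * g z - (lf * g z + f z * lg) * d)%C
    with ((f w - f z - lf * d) * (g w - g z) + lf * d * (g w - g z)
          + (f w - f z - lf * d) * g z + f z * (g w - g z - lg * d))%C by ring.
  eapply Rle_trans; [apply Cmod_triangle|].
  eapply Rle_trans; [apply Rplus_le_compat_r, Cmod_triangle|].
  eapply Rle_trans; [apply Rplus_le_compat_r, Rplus_le_compat_r, Cmod_triangle|].
  rewrite !Cmod_mult.
  set (D := Cmod d) in *. set (U := Cmod (f w - f z - lf * d)) in *.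
  set (V := Cmod (g w - g z)) in *. set (V' := Cmod (g w - g z - lg * d)) in *.
  assert (PD : 0 <= D) by apply Cmod_ge_0. assert (PU : 0 <= U) by apply Cmod_ge_0.
  assert (PV : 0 <= V) by apply Cmod_ge_0. assert (PV' : 0 <= V') by apply Cmod_ge_0.
  assert (HVA : V <= A * D) by (unfold A; nra).
  assert (HVe : V <= A * e) by nra.
  assert (S1 : U * V <= (e * D) * (A * A)).
  { apply Rmult_le_compat; try lra. nra. }
  assert (S2 : Cmod lf * D * V <= (A * D) * (A * e)).
  { apply Rmult_le_compat; try lra. - apply Rmult_le_pos; lra.
    - apply Rmult_le_compat_r; [lra|unfold A; lra]. }
  assert (S3 : U * Cmod (g z) <= (e * D) * (A * A)).
  { apply Rmult_le_compat; try lra. apply Rle_trans with A; [unfold A; lra|nra]. }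
  assert (S4 : Cmod (f z) * V' <= (A * A) * (e * D)).
  { apply Rmult_le_compat; try lra. apply Rle_trans with A; [unfold A; lra|nra]. }
  assert (S5 : 4 * A * A * e * D <= eps * D) by (apply Rmult_le_compat_r; lra).
  lra.
Qed.

(** [2 pi] times the coefficient of [e^(imt)] in the Fourier expansion of [f] on
the circle of centre [x] and radius [rho]. *)
Definition circle_coef (f : C -> C) (x : C) (rho : R) (m : nat) : C :=
  CInt (fun t => f (x + RtoC rho * cis t) * cis (- INR m * t))%C 0 (2 * PI).

(** The function [g(x + w) w^(-m)] at [w = e^u].  The arguments are spelled as
affine maps [A + B * u], the form in which their derivability is available. *)
Definition polar_pullback (g : C -> C) (x : C) (m : nat) (u : C) : C :=
  (g (x + 1 * Cexp u) * Cexp (0 + RtoC (- INR m) * u))%C.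

Lemma ex_derive_polar_pullback (g : C -> C) (x : C) (m : nat) (u : C) :
  complex_derivable g (x + 1 * Cexp u)%C ->
  complex_derivable (polar_pullback g x m) u.
Proof.
  intros Hg. unfold polar_pullback.
  apply (ex_derive_Cmult (fun u => g (x + 1 * Cexp u)%C)
           (fun u => Cexp (0 + RtoC (- INR m) * u)%C)).
  - apply (ex_derive_Ccomp g (fun u => x + 1 * Cexp u)%C); [exact Hg|].
    apply (ex_derive_Ccomp (fun v => x + 1 * v)%C Cexp); [apply ex_derive_affine|].
    eexists; apply is_derive_Cexp.
  - apply (ex_derive_Ccomp Cexp (fun u => 0 + RtoC (- INR m) * u)%C);
      [|apply ex_derive_affine].
    eexists; apply is_derive_Cexp.
Qed.

Lemma Cexp_ln (rho t : R) : 0 < rho -> Cexp (ln rho, t) = (RtoC rho * cis t)%C.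
Proof. intros H; unfold Cexp; simpl; rewrite exp_ln; auto. Qed.

Lemma polar_pullback_circle (g : C -> C) (x : C) (m : nat) (rho t : R) : 0 < rho ->
  polar_pullback g x m (ln rho, t)
  = (RtoC (/ rho ^ m) * (g (x + RtoC rho * cis t) * cis (- INR m * t)))%C.
Proof.
  intros H; unfold polar_pullback. rewrite Cexp_ln, Cmult_1_l by assumption.
  replace (Cexp (0 + RtoC (- INR m) * (ln rho, t)))
    with (RtoC (/ rho ^ m) * cis (- INR m * t))%C; [ring|].
  unfold Cexp, Re, Im; simpl. f_equal.
  - f_equal. rewrite <- Rpower_pow by assumption. unfold Rpower.
    rewrite <- exp_Ropp; f_equal; ring.
  - f_equal; ring.
Qed.

Lemma ex_CInt_circle (g : C -> C) (x : C) (rho : R) (m : nat) : 0 < rho ->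
  (forall z, Cmod (z - x) = rho -> complex_derivable g z) ->
  ex_CInt (fun t => g (x + RtoC rho * cis t) * cis (- INR m * t))%C 0 (2 * PI).
Proof.
  intros Hr Hg.
  apply (ex_CInt_ext (fun t => RtoC (rho ^ m) * polar_pullback g x m (ln rho, t))%C).
  - intros t. rewrite polar_pullback_circle by assumption.
    rewrite Cmult_assoc, <- RtoC_mult, Rinv_r, Cmult_1_l; [reflexivity|].
    apply pow_nonzero; lra.
  - apply (ex_CInt_scal _ (fun t => polar_pullback g x m (ln rho, t))).
    apply (ex_CInt_vertical (polar_pullback g x m)); [generalize PI_RGT_0; lra|]. intros t Ht.
    apply ex_derive_polar_pullback, Hg. rewrite Cexp_ln by assumption.
    replace (x + 1 * (rho * cis t) - x)%C with (rho * cis t)%C by ring.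
    rewrite Cmod_mult, Cmod_cis, Cmod_R, Rabs_pos_eq; lra.
Qed.

(** Vertical segments of length [2 pi] are mapped by [u |-> x + e^u] to circles
about [x].  Along the boundary of a rectangle of that height the integrals of the
pullback over the horizontal sides cancel by periodicity, and Goursat's theorem
equates the two vertical ones. *)
Lemma circle_coef_radius (g : C -> C) (x : C) (rho r : R) (m : nat) : 0 < rho -> rho <= r ->
  (forall z, rho <= Cmod (z - x) <= r ->
     complex_derivable g z) ->
  (RtoC (/ rho ^ m) * circle_coef g x rho m)%C = (RtoC (/ r ^ m) * circle_coef g x r m)%C.
Proof.
  intros Hrho Hr Hg.
  assert (HPI := PI_RGT_0).
  assert (Hln : ln rho <= ln r).
  { destruct Hr as [Hr|<-]; [left; apply ln_increasing|right]; auto. }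
  assert (HG := goursat_rect (polar_pullback g x m) (ln rho) 0 (ln r - ln rho) (2 * PI)
    ltac:(lra) ltac:(lra)).
  assert (HR : derivable_on_rect (polar_pullback g x m) (ln rho) 0 (ln r - ln rho) (2 * PI)).
  { intros u v Hu Hv. apply ex_derive_polar_pullback, Hg.
    replace (x + 1 * Cexp (u, v) - x)%C with (Cexp (u, v)) by ring.
    unfold Cexp; simpl. rewrite Cmod_mult, Cmod_cis, Cmod_R, Rmult_1_r, Rabs_pos_eq
      by (left; apply exp_pos).
    rewrite <- (exp_ln rho) by assumption.
    rewrite <- (exp_ln r) by lra.
    assert (Hexp : forall s t, s <= t -> exp s <= exp t).
    { intros s t [Hst|<-]; [left; apply exp_increasing|right]; auto. }
    split; apply Hexp; lra. }
  specialize (HG HR). unfold rect_integral in HG.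
  replace (ln rho + (ln r - ln rho)) with (ln r) in HG by ring.
  rewrite Rplus_0_l in HG.
  (* The two horizontal sides cancel because the pullback is 2*PI-periodic. *)
  assert (Hper : CInt (fun t => polar_pullback g x m (t, 0)) (ln rho) (ln r)
               = CInt (fun t => polar_pullback g x m (t, (2 * PI)%R)) (ln rho) (ln r)).
  { apply CInt_ext; intros t. unfold polar_pullback, Cexp, Re, Im; simpl.
    replace (0 + (- INR m * 0 + 0 * t)) with 0 by ring.
    replace (0 + (- INR m * (2 * PI) + 0 * t)) with (- (INR m * (2 * PI))) by ring.
    replace (0 + (- INR m * t - 0 * (2 * PI))) with (0 + (- INR m * t - 0 * 0)) by ring.
    assert (H2 : cis (2 * PI) = 1).
    { rewrite <- (cis_INR_2PI 1); f_equal; simpl; ring. }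
    assert (Hm : cis (- (INR m * (2 * PI))) = 1).
    { assert (E : (cis (INR m * (2 * PI)) * cis (- (INR m * (2 * PI))))%C = 1).
      { rewrite <- cis_plus, Rplus_opp_r; apply cis_0. }
      rewrite cis_INR_2PI, Cmult_1_l in E. exact E. }
    rewrite Hm, H2, cis_0; reflexivity. }
  rewrite Hper in HG.
  assert (Hedge : forall q, 0 < q ->
    (forall z, Cmod (z - x) = q -> complex_derivable g z) ->
    CInt (fun t => polar_pullback g x m (ln q, t)) 0 (2 * PI)
    = (RtoC (/ q ^ m) * circle_coef g x q m)%C).
  { intros q Hq Hqz. unfold circle_coef.
    rewrite <- CInt_scal by (apply ex_CInt_circle; assumption).
    apply CInt_ext; intros t; apply polar_pullback_circle; assumption. }
  rewrite <- !Hedge; try lra; try (intros z Hz; apply Hg; lra).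
  set (X := CInt (fun t => polar_pullback g x m (ln rho, t)) 0 (2 * PI)) in *.
  set (Y := CInt (fun t => polar_pullback g x m (ln r, t)) 0 (2 * PI)) in *.
  assert (HXY : (Ci * (Y - X))%C = 0) by (rewrite <- HG; ring).
  symmetry. apply Ceq_minus.
  replace (Y - X)%C with (/ Ci * (Ci * (Y - X)))%C by (field; apply Ci_nz).
  rewrite HXY; ring.
Qed.

Lemma Cmod_circle_coef_le (g : C -> C) (x : C) (rho M : R) (m : nat) : 0 < rho ->
  ex_CInt (fun t => g (x + RtoC rho * cis t) * cis (- INR m * t))%C 0 (2 * PI) ->
  (forall z, Cmod (z - x) = rho -> Cmod (g z) <= M) ->
  Cmod (circle_coef g x rho m) <= 2 * PI * M.
Proof.
  intros Hr Hex HM.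
  replace (2 * PI * M) with ((2 * PI - 0) * M) by ring.
  apply Cmod_CInt_le; [generalize PI_RGT_0; lra|exact Hex|].
  intros t _. rewrite Cmod_mult, Cmod_cis, Rmult_1_r. apply HM.
  replace (x + rho * cis t - x)%C with (rho * cis t)%C by ring.
  rewrite Cmod_mult, Cmod_cis, Cmod_R, Rabs_pos_eq; lra.
Qed.

(** * Circle coefficients of polynomials *)

Definition binom (k m : nat) : R := INR (binomial.binomial k m).

Lemma binom_0_r (k : nat) : binom k 0 = 1.
Proof. unfold binom; rewrite binomial.bin0; reflexivity. Qed.

Lemma binom_0_S (m : nat) : binom 0 (S m) = 0.
Proof. reflexivity. Qed.

Lemma binom_S_S (k m : nat) : binom (S k) (S m) = binom k (S m) + binom k m.
Proof. unfold binom; rewrite binomial.binS; apply plus_INR. Qed.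

Lemma binom_diag (m : nat) : binom m m = 1.
Proof. unfold binom; rewrite binomial.binn; reflexivity. Qed.

Lemma binom_small (k m : nat) : (k < m)%nat -> binom k m = 0.
Proof.
  revert m; induction k as [|k IH]; intros [|m] H; try lia.
  - apply binom_0_S.
  - rewrite binom_S_S, !IH by lia; ring.
Qed.

Lemma binom_S_r (k m : nat) :
  (INR m + 1) * binom k (S m) = (INR k - INR m) * binom k m.
Proof.
  revert m; induction k as [|k IH]; intros m.
  - rewrite binom_0_S. destruct m as [|m]; [simpl|rewrite binom_0_S]; simpl; ring.
  - destruct m as [|m].
    + rewrite binom_S_S. specialize (IH 0%nat). rewrite !binom_0_r in *.
      rewrite S_INR. simpl INR in *. lra.
    + rewrite !binom_S_S.
      assert (H1 := IH (S m)). assert (H0 := IH m). rewrite !S_INR in *. lra.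
Qed.

Lemma binom_S_l (k m : nat) :
  (INR k + 1 - INR m) * binom (S k) m = (INR k + 1) * binom k m.
Proof.
  destruct m as [|m].
  - rewrite !binom_0_r; simpl; ring.
  - rewrite binom_S_S. assert (H := binom_S_r k m). rewrite S_INR in *. lra.
Qed.

Lemma ex_CInt_cis (th a b : R) : ex_CInt (fun t => cis (th * t)) a b.
Proof.
  split; apply (ex_RInt_continuous (V := R_CompleteNormedModule)); intros t _;
    apply (ex_derive_continuous (K := R_AbsRing) (V := R_NormedModule)); simpl;
    auto_derive; trivial.
Qed.

Lemma CInt_cis (th : R) : th <> 0 -> cis (th * (2 * PI)) = 1 ->
  CInt (fun t => cis (th * t)) 0 (2 * PI) = 0.
Proof.
  intros Hth H2. injection H2 as Hc Hs.
  unfold CInt, RtoC; f_equal; simpl.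
  - rewrite (is_RInt_unique _ _ _ (minus (sin (th * (2 * PI)) / th) (sin (th * 0) / th))).
    + rewrite Hs, Rmult_0_r, sin_0. unfold minus, plus, opp; simpl; field; assumption.
    + apply (is_RInt_derive (fun t => sin (th * t) / th)).
      * intros t _. auto_derive; [trivial|field; assumption].
      * intros t _. apply (ex_derive_continuous (K := R_AbsRing) (V := R_NormedModule)).
        auto_derive; trivial.
  - rewrite (is_RInt_unique _ _ _
      (minus (- cos (th * (2 * PI)) / th) (- cos (th * 0) / th))).
    + rewrite Hc, Rmult_0_r, cos_0. unfold minus, plus, opp; simpl; field; assumption.
    + apply (is_RInt_derive (fun t => - cos (th * t) / th)).
      * intros t _. auto_derive; [trivial|field; assumption].
      * intros t _. apply (ex_derive_continuous (K := R_AbsRing) (V := R_NormedModule)).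
        auto_derive; trivial.
Qed.

Lemma pow_circle_step (x : C) (rho th t : R) (k : nat) :
  ((x + RtoC rho * cis t) ^ S k * cis (th * t)
   = x * ((x + RtoC rho * cis t) ^ k * cis (th * t))
     + RtoC rho * ((x + RtoC rho * cis t) ^ k * cis ((th + 1) * t)))%C.
Proof.
  rewrite Cpow_S.
  replace ((th + 1) * t) with (t + th * t) by ring. rewrite cis_plus; ring.
Qed.

Lemma ex_CInt_pow_circle (x : C) (rho : R) (k : nat) (th : R) :
  ex_CInt (fun t => (x + RtoC rho * cis t) ^ k * cis (th * t))%C 0 (2 * PI).
Proof.
  revert th; induction k as [|k IH]; intros th.
  - apply (ex_CInt_ext (fun t => cis (th * t))); [intros t; simpl; ring|apply ex_CInt_cis].
  - eapply ex_CInt_ext; [intros t; symmetry; apply pow_circle_step|].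
    apply ex_CInt_plus; apply ex_CInt_scal, IH.
Qed.

(** By Pascal's rule both sides satisfy the same recursion in [k].  The factor
[x ^ m] avoids the truncated exponent of [x ^ (k - m)].  The induction also carries
the vanishing of the coefficients of negative index, needed at [m = 0]. *)
Lemma circle_coef_pow (x : C) (rho : R) (k m : nat) :
  (x ^ m * circle_coef (fun z => z ^ k) x rho m
   = RtoC (2 * PI * rho ^ m) * (RtoC (binom k m) * x ^ k))%C.
Proof.
  assert (H : (forall m, (x ^ m * circle_coef (fun z => z ^ k) x rho m
                = RtoC (2 * PI * rho ^ m) * (RtoC (binom k m) * x ^ k))%C) /\
              (forall n, CInt (fun t => (x + RtoC rho * cis t) ^ k * cis (INR (S n) * t))%C
                           0 (2 * PI) = 0)).
  2:{ apply H. }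
  clear m. unfold circle_coef. induction k as [|k [IHm IHn]].
  - assert (E : forall th, CInt (fun t => (x + RtoC rho * cis t) ^ 0 * cis (th * t))%C 0 (2 * PI)
                 = CInt (fun t => cis (th * t)) 0 (2 * PI)).
    { intros th; apply CInt_ext; intros t; simpl; ring. }
    split; [intros [|m]|intros n]; rewrite E.
    + rewrite (CInt_ext _ (fun t => RtoC 1 + RtoC t * RtoC 0)%C).
      2:{ intros t; simpl INR. rewrite Ropp_0, Rmult_0_l, cis_0; ring. }
      rewrite (proj2 (is_CInt_affine _ _ _ _)), binom_0_r.
      rewrite Rminus_0_r, pow_O, Rmult_1_r. simpl; ring.
    + rewrite CInt_cis.
      * rewrite binom_0_S; ring.
      * apply Ropp_neq_0_compat, not_0_INR; discriminate.
      * assert (E2 : (cis (INR (S m) * (2 * PI)) * cis (- INR (S m) * (2 * PI)))%C = 1).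
        { rewrite <- cis_plus, <- cis_0; f_equal; ring. }
        rewrite cis_INR_2PI, Cmult_1_l in E2. exact E2.
    + apply CInt_cis; [apply not_0_INR; discriminate|apply cis_INR_2PI].
  - assert (E : forall th, CInt (fun t => (x + RtoC rho * cis t) ^ S k * cis (th * t))%C 0 (2 * PI)
       = (x * CInt (fun t => (x + RtoC rho * cis t) ^ k * cis (th * t))%C 0 (2 * PI)
          + RtoC rho *
            CInt (fun t => (x + RtoC rho * cis t) ^ k * cis ((th + 1) * t))%C 0 (2 * PI))%C).
    { intros th. rewrite <- !CInt_scal by apply ex_CInt_pow_circle.
      rewrite <- CInt_plus by (apply ex_CInt_scal, ex_CInt_pow_circle).
      apply CInt_ext; intros t; apply pow_circle_step. }
    split; [intros [|m]|intros n]; rewrite E.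
    + replace (- INR 0 + 1) with (INR 1) by (simpl; ring). rewrite (IHn 0%nat).
      assert (H0 := IHm 0%nat). rewrite !binom_0_r in *. simpl Cpow in *.
      rewrite !Cmult_1_l in *. rewrite H0; ring.
    + replace (- INR (S m) + 1) with (- INR m) by (rewrite S_INR; ring).
      replace (x ^ S m * (x * CInt (fun t => (x + rho * cis t) ^ k * cis (- INR (S m) * t)) 0 (2 * PI)
                + rho * CInt (fun t => (x + rho * cis t) ^ k * cis (- INR m * t)) 0 (2 * PI)))%C
        with (x * (x ^ S m * CInt (fun t => (x + rho * cis t) ^ k * cis (- INR (S m) * t)) 0 (2 * PI))
              + rho * x * (x ^ m * CInt (fun t => (x + rho * cis t) ^ k * cis (- INR m * t)) 0 (2 * PI)))%C
        by (rewrite (Cpow_S x m); ring).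
      rewrite !IHm, binom_S_S, Cpow_S, <- (tech_pow_Rmult rho m), !RtoC_mult, RtoC_plus; ring.
    + replace (INR (S n) + 1) with (INR (S (S n))) by (rewrite (S_INR (S n)); ring).
      rewrite !IHn; ring.
Qed.

Definition Cpoly (a : nat -> C) (K : nat) (z : C) : C :=
  Csum (fun k => a k * z ^ k)%C K.

(** [z ^ m] times the [m]-th Taylor coefficient at [z] of the [K]-th partial sum. *)
Definition hasse_poly (a : nat -> C) (m K : nat) (z : C) : C :=
  Cpoly (fun k => RtoC (binom k m) * a k)%C K z.

Lemma Csum_S (u : nat -> C) (n : nat) :
  Csum u (S n) = (Csum u n + u (S n))%C.
Proof. apply (sum_Sn (G := C_AbelianMonoid)). Qed.

Lemma Csum_O (u : nat -> C) : Csum u 0 = u 0%nat.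
Proof. apply (sum_O (G := C_AbelianMonoid)). Qed.

Lemma ex_CInt_Cpoly_circle (a : nat -> C) (K : nat) (x : C) (rho th : R) :
  ex_CInt (fun t => Cpoly a K (x + RtoC rho * cis t) * cis (th * t))%C 0 (2 * PI).
Proof.
  unfold Cpoly. induction K as [|K IH].
  - eapply ex_CInt_ext; [|apply (ex_CInt_scal (a 0%nat)), (ex_CInt_pow_circle x rho 0 th)].
    intros t; simpl. rewrite Csum_O; simpl; ring.
  - eapply ex_CInt_ext; [|exact (ex_CInt_plus _ _ _ _ IH
      (ex_CInt_scal (a (S K)) _ _ _ (ex_CInt_pow_circle x rho (S K) th)))].
    intros t; cbv beta. rewrite Csum_S; ring.
Qed.

Lemma circle_coef_Cpoly (a : nat -> C) (K m : nat) (x : C) (rho : R) :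
  (x ^ m * circle_coef (Cpoly a K) x rho m
   = RtoC (2 * PI * rho ^ m) * hasse_poly a m K x)%C.
Proof.
  unfold hasse_poly. induction K as [|K IH].
  - unfold Cpoly at 2; rewrite Csum_O.
    replace (circle_coef (Cpoly a 0) x rho m)
      with (a 0%nat * circle_coef (fun z => z ^ 0) x rho m)%C.
    + replace (x ^ m * (a 0%nat * circle_coef (fun z => z ^ 0) x rho m))%C
        with (a 0%nat * (x ^ m * circle_coef (fun z => z ^ 0) x rho m))%C by ring.
      rewrite circle_coef_pow; ring.
    + unfold circle_coef.
      rewrite <- (CInt_scal _ (fun t => (x + rho * cis t) ^ 0 * cis (- INR m * t))%C)
        by apply ex_CInt_pow_circle.
      apply CInt_ext; intros t. unfold Cpoly; rewrite Csum_O; ring.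
  - unfold Cpoly at 2; rewrite Csum_S; fold (Cpoly (fun k => RtoC (binom k m) * a k)%C K x).
    replace (circle_coef (Cpoly a (S K)) x rho m)
      with (circle_coef (Cpoly a K) x rho m
            + a (S K) * circle_coef (fun z => z ^ S K) x rho m)%C.
    + replace (x ^ m * (circle_coef (Cpoly a K) x rho m
                 + a (S K) * circle_coef (fun z => z ^ S K) x rho m))%C
        with (x ^ m * circle_coef (Cpoly a K) x rho m
              + a (S K) * (x ^ m * circle_coef (fun z => z ^ S K) x rho m))%C by ring.
      rewrite circle_coef_pow, IH; ring.
    + unfold circle_coef.
      rewrite <- (CInt_scal _ (fun t => (x + rho * cis t) ^ S K * cis (- INR m * t))%C)
        by apply ex_CInt_pow_circle.
      rewrite <- CInt_plus.
      * apply CInt_ext; intros t. unfold Cpoly; rewrite Csum_S; ring.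
      * apply ex_CInt_Cpoly_circle.
      * apply ex_CInt_scal, ex_CInt_pow_circle.
Qed.

(** Cauchy's estimate for the partial sums.  The coefficient of [g] on the circle of
radius [rho] is transported to radius [r], where [g] is bounded by [M]; the
difference between [g] and its partial sum is paid for at radius [rho]. *)
Lemma hasse_poly_bound (g : C -> C) (a : nat -> C) (K m : nat) (x : C) (rho r M eps : R) :
  0 < rho -> rho <= r ->
  (forall z, rho <= Cmod (z - x) <= r ->
     complex_derivable g z) ->
  (forall z, Cmod (z - x) = r -> Cmod (g z) <= M) ->
  (forall z, Cmod (z - x) = rho -> Cmod (g z - Cpoly a K z) <= eps) ->
  Cmod (hasse_poly a m K x) <= Cmod x ^ m * (M / r ^ m + eps / rho ^ m).
Proof.
  intros Hrho Hr Hg HM Heps. assert (HPI := PI_RGT_0).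
  assert (Hpr : 0 < rho ^ m) by (apply pow_lt; lra).
  assert (Hpr' : 0 < r ^ m) by (apply pow_lt; lra).
  assert (Hexg : forall q, rho <= q <= r ->
    ex_CInt (fun t => g (x + RtoC q * cis t) * cis (- INR m * t))%C 0 (2 * PI)).
  { intros q Hq; apply ex_CInt_circle; [lra|intros z Hz; apply Hg; lra]. }
  assert (B1 : Cmod (circle_coef g x r m) <= 2 * PI * M).
  { apply Cmod_circle_coef_le; [lra|apply Hexg; lra|exact HM]. }
  assert (Hdiff : circle_coef (fun z => g z - Cpoly a K z)%C x rho m
     = (circle_coef g x rho m - circle_coef (Cpoly a K) x rho m)%C).
  { unfold circle_coef. rewrite <- CInt_minus.
    - apply CInt_ext; intros t; ring.
    - apply Hexg; lra.
    - apply ex_CInt_Cpoly_circle. }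
  assert (B2 : Cmod (circle_coef g x rho m - circle_coef (Cpoly a K) x rho m)
               <= 2 * PI * eps).
  { rewrite <- Hdiff. apply Cmod_circle_coef_le; [lra| |exact Heps].
    eapply ex_CInt_ext; [|exact (ex_CInt_minus _ _ _ _ (Hexg rho ltac:(lra))
      (ex_CInt_Cpoly_circle a K x rho (- INR m)))].
    intros t; cbv beta; ring. }
  assert (Hrad := circle_coef_radius g x rho r m Hrho Hr Hg).
  assert (HC := circle_coef_Cpoly a K m x rho).
  set (G := circle_coef g x rho m) in *. set (G' := circle_coef g x r m) in *.
  set (Q := circle_coef (Cpoly a K) x rho m) in *.
  assert (E : (RtoC (2 * PI) * hasse_poly a m K x)%C
     = (x ^ m * (RtoC (/ r ^ m) * G' - RtoC (/ rho ^ m) * (G - Q)))%C).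
  { rewrite <- Hrad.
    replace (x ^ m * (RtoC (/ rho ^ m) * G - RtoC (/ rho ^ m) * (G - Q)))%C
      with (RtoC (/ rho ^ m) * (x ^ m * Q))%C by ring.
    rewrite HC, Cmult_assoc, <- RtoC_mult. f_equal. f_equal. field. lra. }
  apply (f_equal Cmod) in E. rewrite !Cmod_mult, Cmod_R, Rabs_pos_eq, Cmod_pow in E by lra.
  assert (B3 : Cmod (RtoC (/ r ^ m) * G' - RtoC (/ rho ^ m) * (G - Q))
     <= / r ^ m * (2 * PI * M) + / rho ^ m * (2 * PI * eps)).
  { eapply Rle_trans; [apply Cmod_triangle|].
    rewrite Cmod_opp, !Cmod_mult, !Cmod_R.
    rewrite !Rabs_pos_eq by (left; apply Rinv_0_lt_compat; lra).
    apply Rplus_le_compat; apply Rmult_le_compat_l; try assumption;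
      left; apply Rinv_0_lt_compat; lra. }
  assert (Px : 0 <= Cmod x ^ m) by (apply pow_le, Cmod_ge_0).
  apply (Rmult_le_reg_l (2 * PI)); [lra|]. rewrite E.
  replace (2 * PI * (Cmod x ^ m * (M / r ^ m + eps / rho ^ m)))
    with (Cmod x ^ m * (/ r ^ m * (2 * PI * M) + / rho ^ m * (2 * PI * eps)))
    by (field; lra).
  apply Rmult_le_compat_l; assumption.
Qed.

(** * Taylor coefficients near a regular point *)

Lemma bounded_of_eventually (u : nat -> R) (N : nat) (B : R) :
  (forall k, (N <= k)%nat -> u k <= B) -> exists B', forall k, u k <= B'.
Proof.
  revert B; induction N as [|N IH]; intros B H.
  - exists B; intros k; apply H; lia.
  - apply (IH (Rmax B (u N))). intros k Hk.
    destruct (Nat.eq_dec k N) as [->|Hn]; [apply Rmax_r|].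
    eapply Rle_trans; [apply H; lia|apply Rmax_l].
Qed.

Lemma Cpow_pow_n (z : C) (k : nat) : pow_n (K := C_Ring) z k = (z ^ k)%C.
Proof. induction k as [|k IH]; [reflexivity|]. rewrite Cpow_S, <- IH; reflexivity. Qed.

Lemma is_pseries_Cpoly (a : nat -> C) (z l : C) :
  is_pseries (V := C_NormedModule) a z l ->
  forall eps, 0 < eps -> exists N, forall K, (N <= K)%nat -> Cmod (Cpoly a K z - l) < eps.
Proof.
  intros H eps Heps.
  assert (Hb := proj1 (filterlim_locally_ball_norm (K := C_AbsRing) (U := C_NormedModule) _ l) H
                  (mkposreal eps Heps)).
  destruct Hb as [N HN]. exists N; intros K HK. specialize (HN K HK).
  replace (Cpoly a K z) with
    (Csum (fun k => scal (V := C_NormedModule) (pow_n (K := C_Ring) z k) (a k)) K).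
  - exact HN.
  - unfold Cpoly. apply sum_n_ext. intros k. change (pow_n (K := C_Ring) z k * a k = a k * z ^ k)%C.
    rewrite Cpow_pow_n; ring.
Qed.

Lemma pseries_term_small (a : nat -> C) (z l : C) (eps : R) :
  is_pseries (V := C_NormedModule) a z l -> 0 < eps ->
  exists N, forall k, (N <= k)%nat -> Cmod (a k * z ^ k) < eps.
Proof.
  intros H Heps. destruct (is_pseries_Cpoly a z l H (eps / 2) ltac:(lra)) as [N HN].
  exists (S N). intros [|k] Hk; [lia|].
  assert (H1 := HN (S k) ltac:(lia)). assert (H0 := HN k ltac:(lia)).
  unfold Cpoly in H1; rewrite Csum_S in H1; fold (Cpoly a k z) in H1.
  replace (a (S k) * z ^ S k)%C
    with ((Cpoly a k z + a (S k) * z ^ S k - l) + - (Cpoly a k z - l))%C by ring.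
  eapply Rle_lt_trans; [apply Cmod_triangle|]. rewrite Cmod_opp. lra.
Qed.

(** Comparison with a geometric series: the coefficients are [O(tau^(-k))] for a
[tau] strictly between [sigma] and [1]. *)
Lemma pseries_uniform_approx (a : nat -> C) (g : C -> C) (sigma eps : R) :
  0 <= sigma < 1 -> 0 < eps ->
  (forall z, Cmod z < 1 -> is_pseries (V := C_NormedModule) a z (g z)) ->
  exists K0, forall K, (K0 <= K)%nat -> forall z, Cmod z <= sigma ->
    Cmod (g z - Cpoly a K z) <= eps.
Proof.
  intros Hs Heps Hg.
  pose (tau := (1 + sigma) / 2). assert (Ht : sigma < tau < 1) by (unfold tau; lra).
  assert (HB : exists B, forall k, Cmod (a k) * tau ^ k <= B).
  { destruct (pseries_term_small a tau (g tau) 1) as [N HN].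
    - apply Hg. rewrite Cmod_R, Rabs_pos_eq; lra.
    - lra.
    - apply (bounded_of_eventually _ N 1). intros k Hk. specialize (HN k Hk).
      rewrite Cmod_mult, Cmod_pow, Cmod_R, Rabs_pos_eq in HN; lra. }
  destruct HB as [B HB].
  assert (HB0 : 0 <= B).
  { specialize (HB 0%nat). simpl in HB. generalize (Cmod_ge_0 (a 0%nat)); lra. }
  pose (th := sigma / tau).
  assert (Hth : 0 <= th < 1).
  { unfold th; split; [apply Rcomplements.Rdiv_le_0_compat; lra|].
    apply (Rmult_lt_reg_r tau); [lra|].
    unfold Rdiv; rewrite Rmult_assoc, Rinv_l; lra. }
  assert (Hterm : forall k z, Cmod z <= sigma -> Cmod (a k * z ^ k) <= B * th ^ k).
  { intros k z Hz. rewrite Cmod_mult, Cmod_pow.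
    apply Rle_trans with (Cmod (a k) * sigma ^ k).
    - apply Rmult_le_compat_l; [apply Cmod_ge_0|].
      apply pow_incr; split; [apply Cmod_ge_0|assumption].
    - replace (sigma ^ k) with (tau ^ k * th ^ k).
      + rewrite <- Rmult_assoc. apply Rmult_le_compat_r; [apply pow_le; lra|apply HB].
      + rewrite <- Rpow_mult_distr. f_equal. unfold th; field; lra. }
  assert (Htail : forall j K z, Cmod z <= sigma ->
    Cmod (Cpoly a (K + j) z - Cpoly a K z) <= B * th ^ K * (1 - th ^ j) / (1 - th)).
  { intros j K z Hz; induction j as [|j IH].
    - rewrite Nat.add_0_r. replace (Cpoly a K z - Cpoly a K z)%C with (RtoC 0) by ring.
      rewrite Cmod_0; simpl; apply Req_le; field; lra.
    - rewrite Nat.add_succ_r. unfold Cpoly at 1; rewrite Csum_S; fold (Cpoly a (K + j) z).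
      replace (Cpoly a (K + j) z + a (S (K + j)) * z ^ S (K + j) - Cpoly a K z)%C
        with ((Cpoly a (K + j) z - Cpoly a K z) + a (S (K + j)) * z ^ S (K + j))%C by ring.
      eapply Rle_trans; [apply Cmod_triangle|].
      eapply Rle_trans; [apply Rplus_le_compat; [exact IH|apply Hterm; exact Hz]|].
      assert (Hdec : th ^ S (K + j) <= th ^ (K + j)).
      { simpl. assert (0 <= th ^ (K + j)) by (apply pow_le; lra). nra. }
      apply (Rmult_le_compat_l B) in Hdec; [|assumption].
      eapply Rle_trans; [apply Rplus_le_compat_l; exact Hdec|].
      rewrite pow_add. simpl. apply Req_le. field. lra. }
  destruct (pow_lt_1_zero th) with (y := eps / 2 * (1 - th) / (B + 1)) as [K0 HK0].
  { rewrite Rabs_pos_eq; lra. }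
  { apply Rdiv_lt_0_compat; [apply Rmult_lt_0_compat|]; lra. }
  exists K0. intros K HK z Hz.
  destruct (is_pseries_Cpoly a z (g z) (Hg z ltac:(lra)) (eps / 2) ltac:(lra)) as [N HN].
  specialize (HN (K + N)%nat ltac:(lia)).
  replace (g z - Cpoly a K z)%C
    with (- (Cpoly a (K + N) z - g z) + (Cpoly a (K + N) z - Cpoly a K z))%C by ring.
  eapply Rle_trans; [apply Cmod_triangle|]. rewrite Cmod_opp.
  assert (T := Htail N K z Hz).
  assert (Hfin : B * th ^ K * (1 - th ^ N) / (1 - th) <= eps / 2).
  { specialize (HK0 K HK). rewrite Rabs_pos_eq in HK0 by (apply pow_le; lra).
    assert (P : 0 <= th ^ K) by (apply pow_le; lra).
    assert (P' : 0 <= th ^ N) by (apply pow_le; lra).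
    assert (Q : (B + 1) * th ^ K <= eps / 2 * (1 - th)).
    { apply (Rmult_lt_compat_l (B + 1)) in HK0; [|lra].
      replace ((B + 1) * (eps / 2 * (1 - th) / (B + 1))) with (eps / 2 * (1 - th)) in HK0
        by (field; lra). lra. }
    apply (Rmult_le_reg_r (1 - th)); [lra|].
    unfold Rdiv at 1; rewrite Rmult_assoc, Rinv_l, Rmult_1_r by lra.
    apply Rle_trans with ((B + 1) * th ^ K); [|exact Q].
    assert (0 <= B * th ^ K) by (apply Rmult_le_pos; lra). nra. }
  lra.
Qed.

Lemma bounded_near_one (g : C -> C) (d : R) : 0 < d ->
  (forall z, Cmod (z - 1) < 9 * d -> complex_derivable g z) ->
  exists M, forall z, Cmod (z - 1) <= 4 * d -> Cmod (g z) <= M.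
Proof.
  intros Hd Hg.
  destruct (bisection_2d (fun x y w h => exists M, forall u v,
      x <= u <= x + w -> y <= v <= y + h -> Cmod (g (u, v)) <= M)
    (1 - 4 * d) (- (4 * d)) (8 * d) (8 * d)) as [M HM]; try lra.
  - intros x y w h Hw Hh [M1 H1] [M2 H2] [M3 H3] [M4 H4].
    exists (Rmax (Rmax M1 M2) (Rmax M3 M4)). intros u v Hu Hv.
    assert (L1 := Rmax_l (Rmax M1 M2) (Rmax M3 M4)). assert (L2 := Rmax_r (Rmax M1 M2) (Rmax M3 M4)).
    assert (L3 := Rmax_l M1 M2). assert (L4 := Rmax_r M1 M2).
    assert (L5 := Rmax_l M3 M4). assert (L6 := Rmax_r M3 M4).
    destruct (Rle_dec u (x + w / 2)), (Rle_dec v (y + h / 2)).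
    + specialize (H1 u v ltac:(lra) ltac:(lra)); lra.
    + specialize (H3 u v ltac:(lra) ltac:(lra)); lra.
    + specialize (H2 u v ltac:(lra) ltac:(lra)); lra.
    + specialize (H4 u v ltac:(lra) ltac:(lra)); lra.
  - intros p q Hp Hq.
    destruct (complex_derive_lipschitz g (p, q)) as [K [delta [Hd0 HK]]].
    { apply Hg. eapply Rle_lt_trans; [apply Cmod_le_abs|]. unfold Re, Im; simpl.
      assert (Rabs (p + - (1)) <= 4 * d) by (apply Rabs_le; lra).
      assert (Rabs (q + - 0) <= 4 * d) by (apply Rabs_le; lra). lra. }
    exists delta; split; [assumption|].
    intros x' y' w' h' _ _ _ _ Hp' Hq' Hsm.
    exists (Cmod (g (p, q)) + Rabs K * delta). intros u v Hu Hv.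
    assert (Hdist : Cmod ((u, v) - (p, q)) < delta).
    { eapply Rle_lt_trans; [apply Cmod_le_abs|]. unfold Re, Im; simpl.
      assert (Rabs (u + - p) <= w') by (apply Rabs_le; lra).
      assert (Rabs (v + - q) <= h') by (apply Rabs_le; lra). lra. }
    specialize (HK _ Hdist).
    replace (g (u, v)) with (g (p, q) + (g (u, v) - g (p, q)))%C by ring.
    eapply Rle_trans; [apply Cmod_triangle|]. apply Rplus_le_compat_l.
    eapply Rle_trans; [exact HK|].
    assert (Hc := Cmod_ge_0 ((u, v) - (p, q))).
    assert (HKa := Rle_abs K). assert (HKp := Rabs_pos K). nra.
  - exists M. intros [u v] Hz. apply HM.
    + assert (H := re_le_Cmod ((u, v) - 1)). unfold Re in H; simpl in H.
      assert (H' : Rabs (u + - (1)) <= 4 * d) by lra.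
      apply Rabs_le_between in H'. lra.
    + assert (H := im_le_Cmod ((u, v) - 1)). unfold Im in H; simpl in H.
      assert (H' : Rabs (v + - 0) <= 4 * d) by lra.
      apply Rabs_le_between in H'. lra.
Qed.

Lemma Cmod_cis_minus_1 (t : R) : Cmod (cis t - 1) = 2 * Rabs (sin (t / 2)).
Proof.
  replace (2 * Rabs (sin (t / 2))) with (sqrt ((2 * Rabs (sin (t / 2))) ^ 2)).
  2:{ apply sqrt_pow2. generalize (Rabs_pos (sin (t / 2))); lra. }
  unfold Cmod; f_equal. rewrite Rpow_mult_distr, pow2_abs.
  unfold cis; simpl. replace t with (2 * (t / 2)) at 1 2 3 4 by field.
  rewrite cos_2a_sin, sin_2a.
  assert (E := sin2_cos2 (t / 2)); unfold Rsqr in E.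
  set (s := sin (t / 2)) in *. set (c := cos (t / 2)) in *.
  assert (Hc : c * c = 1 - s * s) by lra.
  transitivity (4 * (s * s) * (s * s) + 4 * (s * s) * (c * c)); [ring|].
  rewrite Hc; ring.
Qed.

Lemma Rabs_sin_le (t : R) : Rabs (sin t) <= Rabs t.
Proof.
  assert (H : forall u, 0 <= u -> Rabs (sin u) <= u).
  { intros u Hu. apply Rabs_le. split.
    - destruct (Rle_dec u PI) as [Hp|Hp].
      + assert (H := sin_ge_0 u Hu Hp); lra.
      + assert (H := SIN_bound u). generalize PI2_1; lra.
    - destruct Hu as [Hu|<-]; [left; apply sin_lt_x; assumption|rewrite sin_0; lra]. }
  destruct (Rle_dec 0 t) as [Ht|Ht].
  - rewrite (Rabs_pos_eq t) by assumption; apply H; assumption.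
  - rewrite <- (Rabs_Ropp t), <- Rabs_Ropp, <- sin_neg, (Rabs_pos_eq (- t)) by lra.
    apply H; lra.
Qed.

(** The constants fit together as follows: [|x - 1| <= 2 d] for every [x] on the
arc, so the discs of radius [2 d] about these points stay in [|z - 1| <= 4 d]; the
circles of radius [d / 2] stay in [|z| <= 1 - d / 2], where the partial sums
approximate [g] uniformly, here up to [(1 / 4)^m], the [m]-th power of the ratio
of the two radii. *)
Lemma hasse_poly_bound_near_one (a : nat -> C) (g : C -> C) (d : R) : 0 < d <= 1 / 9 ->
  (forall z, Cmod z < 1 -> is_pseries (V := C_NormedModule) a z (g z)) ->
  (forall z, Cmod (z - 1) < 9 * d -> complex_derivable g z) ->
  exists M, 0 < M /\ forall m, exists K0, forall K t, (K0 <= K)%nat -> Rabs t <= d ->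
    Cmod (hasse_poly a m K (RtoC (1 - d) * cis t)) <= M * ((1 - d) / (2 * d)) ^ m.
Proof.
  intros Hd Hps Hg.
  destruct (bounded_near_one g d (proj1 Hd) Hg) as [M HM].
  assert (HM0 : 0 <= M).
  { eapply Rle_trans; [apply Cmod_ge_0|apply (HM 1)].
    replace (1 - 1)%C with (RtoC 0) by ring. rewrite Cmod_0; lra. }
  exists (M + 1); split; [lra|]. intros m.
  destruct (pseries_uniform_approx a g (1 - d / 2) ((1 / 4) ^ m)) as [K0 HK0];
    [lra|apply pow_lt; lra|exact Hps|].
  exists K0. intros K t HK Ht.
  set (x := (RtoC (1 - d) * cis t)%C).
  assert (Hx : Cmod x = 1 - d).
  { unfold x; rewrite Cmod_mult, Cmod_cis, Cmod_R, Rabs_pos_eq; lra. }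
  assert (Hx1 : Cmod (x - 1) <= 2 * d).
  { replace (x - 1)%C with ((cis t - 1) + - (RtoC d * cis t))%C.
    2:{ unfold x; rewrite RtoC_minus; ring. }
    eapply Rle_trans; [apply Cmod_triangle|].
    rewrite Cmod_opp, Cmod_mult, Cmod_cis, Cmod_R, Cmod_cis_minus_1, (Rabs_pos_eq d) by lra.
    assert (Hs := Rabs_sin_le (t / 2)). unfold Rdiv in Hs at 2.
    rewrite Rabs_mult, (Rabs_pos_eq (/ 2)) in Hs by lra. lra. }
  assert (Htri : forall z, Cmod (z - 1) <= Cmod (z - x) + 2 * d).
  { intros z. replace (z - 1)%C with ((z - x) + (x - 1))%C by ring.
    eapply Rle_trans; [apply Cmod_triangle|lra]. }
  eapply Rle_trans.
  - apply (hasse_poly_bound g a K m x (d / 2) (2 * d) M ((1 / 4) ^ m)); try lra.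
    + intros z Hz; apply Hg. specialize (Htri z); lra.
    + intros z Hz; apply HM. specialize (Htri z); lra.
    + intros z Hz; apply HK0; [assumption|].
      replace z with (x + (z - x))%C by ring.
      eapply Rle_trans; [apply Cmod_triangle|lra].
  - rewrite Hx. apply Req_le.
    replace (1 / 4) with (d / 2 / (2 * d)) by (field; lra).
    unfold Rdiv. rewrite !Rpow_mult_distr, !pow_inv, !Rpow_mult_distr.
    field. repeat split; try apply pow_nonzero; lra.
Qed.

(** * Fejer averages over an arc *)

Lemma Csum_ext (u v : nat -> C) (n : nat) : (forall k, u k = v k) ->
  Csum u n = Csum v n.
Proof. intros H; apply (sum_n_ext (G := C_AbelianMonoid)); exact H. Qed.

Lemma Csum_plus (u v : nat -> C) (n : nat) :
  Csum (fun k => u k + v k)%C n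
  = (Csum u n + Csum v n)%C.
Proof. apply (sum_n_plus (G := C_AbelianMonoid)). Qed.

Lemma Csum_mult_l (c : C) (u : nat -> C) (n : nat) :
  Csum (fun k => c * u k)%C n
  = (c * Csum u n)%C.
Proof. apply (sum_n_mult_l (K := C_Ring)). Qed.

Lemma Rsum_S (u : nat -> R) (n : nat) :
  Rsum u (S n) = Rsum u n + u (S n).
Proof. apply (sum_Sn (G := R_AbelianMonoid)). Qed.

Lemma Rsum_O (u : nat -> R) : Rsum u 0 = u 0%nat.
Proof. apply (sum_O (G := R_AbelianMonoid)). Qed.

Lemma Re_Csum (u : nat -> C) (n : nat) :
  Re (Csum u n) = Rsum (fun k => Re (u k)) n.
Proof.
  induction n as [|n IH]; [rewrite Csum_O, Rsum_O; reflexivity|].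
  rewrite Csum_S, Rsum_S, re_plus, IH; reflexivity.
Qed.

Lemma Cconj_Csum (u : nat -> C) (n : nat) :
  Cconj (Csum u n)
  = Csum (fun k => Cconj (u k)) n.
Proof.
  induction n as [|n IH]; [rewrite !Csum_O; reflexivity|].
  rewrite !Csum_S, Cplus_conj, IH; reflexivity.
Qed.

Lemma Cmod_Csum_le (u : nat -> C) (n : nat) (B : R) :
  (forall k, (k <= n)%nat -> Cmod (u k) <= B) ->
  Cmod (Csum u n) <= (INR n + 1) * B.
Proof.
  induction n as [|n IH]; intros H.
  - rewrite Csum_O. simpl. specialize (H 0%nat ltac:(lia)); lra.
  - rewrite Csum_S, S_INR. eapply Rle_trans; [apply Cmod_triangle|].
    specialize (IH ltac:(intros k Hk; apply H; lia)). specialize (H (S n) ltac:(lia)). lra.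
Qed.

Definition dirichlet (N : nat) (th : R) : C :=
  Csum (fun l => cis (INR l * th)) N.

Lemma dirichlet_0 (N : nat) : dirichlet N 0 = RtoC (INR N + 1).
Proof.
  unfold dirichlet; induction N as [|N IH].
  - rewrite Csum_O, Rmult_0_r, cis_0. simpl; f_equal; ring.
  - rewrite Csum_S, IH, Rmult_0_r, cis_0, S_INR, !RtoC_plus; ring.
Qed.

Lemma dirichlet_telescope (N : nat) (th : R) :
  ((cis th - 1) * dirichlet N th = cis (INR (S N) * th) - 1)%C.
Proof.
  unfold dirichlet; induction N as [|N IH].
  - rewrite Csum_O. simpl. rewrite Rmult_0_l, Rmult_1_l, cis_0; ring.
  - rewrite Csum_S, Cmult_plus_distr_l, IH.
    replace (INR (S (S N)) * th) with (th + INR (S N) * th) by (rewrite (S_INR (S N)); ring).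
    rewrite cis_plus; ring.
Qed.

(** The mean value theorem, with [cos >= 1 / 2] on [0, PI / 3] and [1 <= PI / 3]. *)
Lemma sin_ge_half (u : R) : 0 <= u <= 1 -> u / 2 <= sin u.
Proof.
  intros [[Hu|<-] Hu1]; [|rewrite sin_0; lra].
  destruct (MVT_cor2 sin cos 0 u Hu) as [c [Hc Hc']].
  { intros c _; apply derivable_pt_lim_sin. }
  rewrite sin_0 in Hc.
  assert (H3 := PI2_3_2).
  assert (Hcos : 1 / 2 <= cos c).
  { rewrite <- cos_PI3. apply cos_decr_1; lra. }
  nra.
Qed.

Lemma Cmod_cis_minus_1_ge (th : R) : Rabs th <= 1 -> Rabs th / 2 <= Cmod (cis th - 1).
Proof.
  intros H. rewrite Cmod_cis_minus_1.
  assert (E : Rabs (sin (th / 2)) = Rabs (sin (Rabs th / 2))).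
  { unfold Rabs at 3; destruct Rcase_abs; [|reflexivity].
    replace (- th / 2) with (- (th / 2)) by field.
    rewrite sin_neg, Rabs_Ropp; reflexivity. }
  rewrite E. assert (Hp := Rabs_pos th).
  assert (Hs := sin_ge_half (Rabs th / 2) ltac:(lra)).
  assert (Hl := Rle_abs (sin (Rabs th / 2))). lra.
Qed.

Lemma dirichlet_bound (N : nat) (th : R) : 0 < Rabs th <= 1 ->
  Cmod (dirichlet N th) ^ 2 <= 16 / th ^ 2.
Proof.
  intros H. assert (T := f_equal Cmod (dirichlet_telescope N th)).
  rewrite Cmod_mult in T.
  assert (H2 : Cmod (cis (INR (S N) * th) - 1) <= 2).
  { eapply Rle_trans; [apply Cmod_triangle|]. rewrite Cmod_opp, Cmod_cis, Cmod_1; lra. }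
  assert (H3 := Cmod_cis_minus_1_ge th (proj2 H)).
  assert (HD := Cmod_ge_0 (dirichlet N th)).
  set (D := Cmod (dirichlet N th)) in *.
  assert (H4 : Rabs th * D <= 4) by nra.
  rewrite <- (pow2_abs th).
  apply (Rmult_le_reg_r (Rabs th ^ 2)); [apply pow_lt; lra|].
  unfold Rdiv; rewrite Rmult_assoc, Rinv_l, Rmult_1_r by (apply pow_nonzero; lra).
  rewrite <- Rpow_mult_distr. replace 16 with (4 ^ 2) by ring.
  apply pow_incr; split; [apply Rmult_le_pos|]; lra.
Qed.

(** Averaging over the differences of two equidistant angles produces a square: the
multipliers are nonnegative, and decay quadratically by [dirichlet_bound]. *)
Lemma fejer_kernel (N : nat) (th : R) :
  Csum (fun l =>
    Csum (fun l' => cis ((INR l - INR l') * th)) N) N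
  = RtoC (Cmod (dirichlet N th) ^ 2).
Proof.
  rewrite Cmod2_conj. unfold dirichlet at 2.
  rewrite Cconj_Csum.
  set (D' := Csum (fun k => Cconj (cis (INR k * th))) N).
  rewrite (Cmult_comm (dirichlet N th)). unfold dirichlet. rewrite <- Csum_mult_l.
  apply Csum_ext; intros l. unfold D'. rewrite Cmult_comm, <- Csum_mult_l.
  apply Csum_ext; intros l'.
  replace ((INR l - INR l') * th) with (INR l * th + - (INR l' * th)) by ring.
  rewrite cis_plus. f_equal. unfold cis, Cconj; simpl.
  rewrite cos_neg, sin_neg; reflexivity.
Qed.

Definition trig_poly (A : nat -> C) (K : nat) (t : R) : C :=
  Csum (fun k => A k * cis (INR k * t))%C K.

Lemma fejer_average (A : nat -> C) (K N n : nat) (h : R) :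
  Csum (fun l =>
    Csum (fun l' =>
      cis (- (INR n * ((INR l - INR l') * h))) * trig_poly A K ((INR l - INR l') * h))%C N) N
  = Csum
      (fun k => A k * RtoC (Cmod (dirichlet N ((INR k - INR n) * h)) ^ 2))%C K.
Proof.
  assert (Hone : forall k,
    Csum (fun l =>
      Csum (fun l' =>
        cis (- (INR n * ((INR l - INR l') * h))) * (A k * cis (INR k * ((INR l - INR l') * h))))%C N) N
    = (A k * RtoC (Cmod (dirichlet N ((INR k - INR n) * h)) ^ 2))%C).
  { intros k. rewrite <- fejer_kernel, <- Csum_mult_l.
    apply Csum_ext; intros l. rewrite <- Csum_mult_l. apply Csum_ext; intros l'.
    replace ((INR l - INR l') * ((INR k - INR n) * h))
      with (- (INR n * ((INR l - INR l') * h)) + INR k * ((INR l - INR l') * h)) by ring.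
    rewrite cis_plus; ring. }
  induction K as [|K IH].
  - rewrite Csum_O, <- Hone. apply Csum_ext; intros l; apply Csum_ext; intros l'.
    unfold trig_poly; rewrite Csum_O; reflexivity.
  - rewrite Csum_S, <- IH, <- Hone, <- Csum_plus.
    apply Csum_ext; intros l. rewrite <- Csum_plus. apply Csum_ext; intros l'.
    unfold trig_poly; rewrite Csum_S; ring.
Qed.

Lemma fejer_average_bound (A : nat -> C) (K N n : nat) (h B : R) : 0 <= h ->
  (forall t, Rabs t <= INR N * h -> Cmod (trig_poly A K t) <= B) ->
  Cmod (Csum
      (fun k => A k * RtoC (Cmod (dirichlet N ((INR k - INR n) * h)) ^ 2))%C K)
  <= (INR N + 1) ^ 2 * B.
Proof.
  intros Hh HB. rewrite <- fejer_average.
  replace ((INR N + 1) ^ 2 * B) with ((INR N + 1) * ((INR N + 1) * B)) by ring.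
  apply Cmod_Csum_le; intros l Hl. apply Cmod_Csum_le; intros l' Hl'.
  rewrite Cmod_mult, Cmod_cis, Rmult_1_l. apply HB.
  rewrite Rabs_mult, (Rabs_pos_eq h) by assumption. apply Rmult_le_compat_r; [assumption|].
  apply le_INR in Hl, Hl'. assert (P := pos_INR l). assert (P' := pos_INR l').
  apply Rabs_le; lra.
Qed.

(** The lower bounds telescope on either side of [n], and each side costs at most
[E / J]. *)
Lemma sum_around_peak (c : nat -> R) (n K : nat) (J E : R) : 1 < J -> 0 <= E -> (n <= K)%nat ->
  1 <= c n ->
  (forall k, (k <= K)%nat -> k <> n -> - E * (/ (Rabs (INR k - INR n) + J - 1) - / (Rabs (INR k - INR n) + J))
                       <= c k) ->
  1 - 2 * E / J <= Rsum c K.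
Proof.
  intros HJ HE HnK Hcn Hck.
  assert (Hlow : forall p, (p < n)%nat ->
    - E * / (INR n - INR p + J - 1) <= Rsum c p).
  { induction p as [|p IH]; intros Hp.
    - rewrite Rsum_O. eapply Rle_trans; [|apply Hck; lia].
      apply lt_INR in Hp. simpl in *.
      replace (Rabs (0 - INR n)) with (INR n)
        by (rewrite Rminus_0_l, Rabs_Ropp, Rabs_pos_eq; lra).
      rewrite Rminus_0_r.
      assert (0 < / (INR n + J)) by (apply Rinv_0_lt_compat; lra). nra.
    - rewrite Rsum_S. specialize (IH ltac:(lia)). specialize (Hck (S p) ltac:(lia) ltac:(lia)).
      apply lt_INR in Hp.
      rewrite (Rabs_left (INR (S p) - INR n)) in Hck by lra.
      rewrite S_INR in *.
      replace (- (INR p + 1 - INR n) + J) with (INR n - INR p + J - 1) in Hck by ring.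
      replace (INR n - (INR p + 1) + J - 1) with (INR n - INR p + J - 1 - 1) by ring. lra. }
  assert (Hhigh : forall j, (n + j <= K)%nat ->
    1 - 2 * E / J + E * / (INR j + J) <= Rsum c (n + j)).
  { induction j as [|j IH]; intros Hj.
    - rewrite Nat.add_0_r. simpl INR. rewrite Rplus_0_l.
      destruct n as [|n].
      + rewrite Rsum_O. assert (0 <= E * / J).
        { apply Rmult_le_pos; [lra|left; apply Rinv_0_lt_compat; lra]. } unfold Rdiv; lra.
      + rewrite Rsum_S. specialize (Hlow n ltac:(lia)). rewrite S_INR in Hlow.
        replace (INR n + 1 - INR n + J - 1) with J in Hlow by ring. unfold Rdiv; lra.
    - rewrite Nat.add_succ_r, Rsum_S.
      specialize (Hck (S (n + j)) ltac:(lia) ltac:(lia)). specialize (IH ltac:(lia)).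
      rewrite S_INR, plus_INR in Hck. assert (P := pos_INR j).
      rewrite Rabs_pos_eq in Hck by lra. rewrite S_INR.
      replace (INR n + INR j + 1 - INR n + J - 1) with (INR j + J) in Hck by ring.
      replace (INR n + INR j + 1 - INR n + J) with (INR j + 1 + J) in Hck by ring. lra. }
  specialize (Hhigh (K - n)%nat ltac:(lia)). replace (n + (K - n))%nat with K in Hhigh by lia.
  eapply Rle_trans; [|exact Hhigh].
  assert (0 <= E * / (INR (K - n) + J)).
  { apply Rmult_le_pos; [lra|left; apply Rinv_0_lt_compat; generalize (pos_INR (K - n)); lra]. }
  lra.
Qed.

(** A coefficient that dominates all others and is nearly repeated on a window about
its index cannot be cancelled on an arc: the arc sees it through the nonnegative
multipliers of [fejer_average].  Normalized to [1] at [k = n] they are at most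
[16 / (eta (k - n))^2], and [J] is large enough for the sum of these bounds
outside the window not to exceed [1 / 2]. *)
Lemma peak_le_arc_sup (A : nat -> C) (K n : nat) (J eta B : R) :
  0 < eta <= 1 -> (n <= K)%nat -> 1 < J -> 256 / eta ^ 2 <= J ->
  (forall k, Cmod (A k) <= Cmod (A n)) ->
  (forall k, Rabs (INR k - INR n) <= J -> Cmod (A k - A n) <= Cmod (A n)) ->
  (forall t, Rabs t <= eta -> Cmod (trig_poly A K t) <= B) ->
  Cmod (A n) <= 2 * B.
Proof.
  intros Heta HnK HJ HJe Hpeak Hnear HB.
  assert (HB0 : 0 <= B).
  { eapply Rle_trans; [apply Cmod_ge_0|apply (HB 0)]. rewrite Rabs_R0; lra. }
  destruct (Req_dec (Cmod (A n)) 0) as [H0|H0]; [lra|].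
  assert (HA : 0 < Cmod (A n)) by (generalize (Cmod_ge_0 (A n)); lra).
  set (a := Cmod (A n)) in *.
  (* With this mesh all the angles (k - n) h with k <= K are at most 1. *)
  pose (L := INR K + 1). pose (h := eta / L).
  assert (PK := pos_INR K).
  assert (HL : 1 <= L) by (unfold L; lra).
  assert (Hh : 0 < h) by (apply Rdiv_lt_0_compat; lra).
  assert (HhL : h * L = eta) by (unfold h; field; lra).
  pose (S' := Csum
     (fun k => A k * RtoC (Cmod (dirichlet K ((INR k - INR n) * h)) ^ 2))%C K).
  assert (HS : Cmod S' <= L ^ 2 * B).
  { apply fejer_average_bound; [lra|]. intros t Ht; apply HB. unfold L in HhL. nra. }
  pose (c k := Re (A k * Cconj (A n)) * Cmod (dirichlet K ((INR k - INR n) * h)) ^ 2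
                / (a ^ 2 * L ^ 2)).
  assert (Hsum : Re (S' * Cconj (A n)) = a ^ 2 * L ^ 2 * Rsum c K).
  { unfold S'. rewrite Cmult_comm, <- Csum_mult_l, Re_Csum.
    rewrite <- (sum_n_mult_l (K := R_Ring) (a ^ 2 * L ^ 2)).
    apply (sum_n_ext (G := R_AbelianMonoid)). intros k. unfold c.
    change (Re (Cconj (A n) * (A k * RtoC (Cmod (dirichlet K ((INR k - INR n) * h)) ^ 2)))
      = a ^ 2 * L ^ 2 * (Re (A k * Cconj (A n)) * Cmod (dirichlet K ((INR k - INR n) * h)) ^ 2
                / (a ^ 2 * L ^ 2))).
    rewrite Cmult_assoc, (Cmult_comm (Cconj (A n))), re_scal_r. field. lra. }
  assert (Hc : 1 - 2 * (64 / eta ^ 2) / J <= Rsum c K).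
  { apply sum_around_peak with n; try assumption.
    - apply Rcomplements.Rdiv_le_0_compat; [lra|apply pow_lt; lra].
    - unfold c. rewrite Rminus_diag, Rmult_0_l, dirichlet_0, Cmod_R.
      rewrite Rabs_pos_eq by lra. fold L.
      rewrite <- Cmod2_conj, re_RtoC. fold a. apply Req_le. field. lra.
    - intros k HkK Hk.
      assert (Hj : 1 <= Rabs (INR k - INR n)).
      { destruct (Nat.lt_total k n) as [Hlt|[Heq|Hgt]]; [|contradiction|].
        - apply le_INR in Hlt. rewrite S_INR in Hlt. rewrite Rabs_left; lra.
        - apply le_INR in Hgt. rewrite S_INR in Hgt. rewrite Rabs_pos_eq; lra. }
      assert (HjK : Rabs (INR k - INR n) <= INR K).
      { apply le_INR in HkK, HnK. assert (P := pos_INR k). assert (P' := pos_INR n).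
        apply Rabs_le; lra. }
      assert (Ht : Rabs ((INR k - INR n) * h) = Rabs (INR k - INR n) * h).
      { rewrite Rabs_mult, (Rabs_pos_eq h); lra. }
      assert (HD := dirichlet_bound K ((INR k - INR n) * h)).
      rewrite Ht in HD. rewrite <- (pow2_abs ((INR k - INR n) * h)), Ht in HD.
      unfold c. set (j := Rabs (INR k - INR n)) in *.
      set (D2 := Cmod (dirichlet K ((INR k - INR n) * h)) ^ 2) in *.
      assert (HD2 : 0 <= D2) by apply pow2_ge_0.
      assert (Hjh : 0 < j * h <= 1).
      { split; [nra|]. unfold L in HhL. nra. }
      specialize (HD Hjh).
      assert (HE : 0 <= 64 / eta ^ 2).
      { apply Rcomplements.Rdiv_le_0_compat; [lra|apply pow_lt; lra]. }
      assert (Hdiff : / (j + J - 1) - / (j + J) = / ((j + J - 1) * (j + J))) by (field; lra).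
      rewrite Hdiff.
      assert (Hinv : 0 < / ((j + J - 1) * (j + J))) by (apply Rinv_0_lt_compat; nra).
      assert (HaL : 0 < a ^ 2 * L ^ 2) by (apply Rmult_lt_0_compat; apply pow_lt; lra).
      destruct (Rle_dec j J) as [HjJ|HjJ].
      + apply Rle_trans with 0; [nra|].
        apply Rcomplements.Rdiv_le_0_compat; [|exact HaL].
        apply Rmult_le_pos; [|exact HD2].
        replace (A k * Cconj (A n))%C with (RtoC (a ^ 2) + (A k - A n) * Cconj (A n))%C.
        2:{ unfold a; rewrite Cmod2_conj; ring. }
        rewrite re_plus, re_RtoC.
        assert (Hre := re_le_Cmod ((A k - A n) * Cconj (A n))).
        rewrite Cmod_mult, Cmod_conj in Hre. fold a in Hre.
        apply Rabs_le_between in Hre. specialize (Hnear k HjJ). nra.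
      + assert (Hre := re_le_Cmod (A k * Cconj (A n))).
        rewrite Cmod_mult, Cmod_conj in Hre. fold a in Hre.
        apply Rabs_le_between in Hre. specialize (Hpeak k).
        assert (Hre' : - a ^ 2 <= Re (A k * Cconj (A n))) by nra.
        apply Rle_trans with (- a ^ 2 * D2 / (a ^ 2 * L ^ 2)).
        2:{ apply Rmult_le_compat_r; [left; apply Rinv_0_lt_compat; exact HaL|].
            apply Rmult_le_compat_r; assumption. }
        replace (- a ^ 2 * D2 / (a ^ 2 * L ^ 2)) with (- (D2 / L ^ 2)) by (field; lra).
        rewrite Ropp_mult_distr_l_reverse. apply Ropp_le_contravar.
        apply Rle_trans with (16 / (j * h) ^ 2 / L ^ 2).
        { apply Rmult_le_compat_r; [left; apply Rinv_0_lt_compat, pow_lt; lra|exact HD]. }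
        replace (16 / (j * h) ^ 2 / L ^ 2) with (64 / eta ^ 2 * / (4 * j ^ 2)).
        2:{ rewrite <- HhL. field. lra. }
        apply Rmult_le_compat_l; [exact HE|].
        apply Rinv_le_contravar; [nra|].
        assert (HjJ' : J <= j) by lra.
        replace (4 * j ^ 2) with ((2 * j) * (2 * j)) by ring.
        apply Rmult_le_compat; lra. }
  assert (HE : 2 * (64 / eta ^ 2) / J <= 1 / 2).
  { apply (Rmult_le_reg_r J); [lra|]. unfold Rdiv at 1. rewrite Rmult_assoc, Rinv_l by lra.
    replace (2 * (64 / eta ^ 2) * 1) with (1 / 2 * (256 / eta ^ 2)) by (field; lra). lra. }
  assert (Hre := re_le_Cmod (S' * Cconj (A n))).
  rewrite Cmod_mult, Cmod_conj, Hsum in Hre. fold a in Hre.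
  apply Rabs_le_between in Hre.
  assert (HL2 : 0 < L ^ 2) by (apply pow_lt; lra).
  assert (Hlo : a ^ 2 * L ^ 2 * (1 / 2) <= a * (L ^ 2 * B)).
  { apply Rle_trans with (a ^ 2 * L ^ 2 * Rsum c K).
    - apply Rmult_le_compat_l; [|lra]. apply Rmult_le_pos; [apply pow2_ge_0|lra].
    - eapply Rle_trans; [apply Hre|]. rewrite Rmult_comm.
      apply Rmult_le_compat_l; lra. }
  apply (Rmult_le_reg_l (a * L ^ 2)); [apply Rmult_lt_0_compat; lra|]. nra.
Qed.

(** * The largest term *)

Definition hasse_term (a : nat -> C) (y : R) (m k : nat) : C :=
  (RtoC (binom k m * y ^ k) * a k)%C.

Lemma hasse_poly_circle (a : nat -> C) (y t : R) (m K : nat) :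
  hasse_poly a m K (RtoC y * cis t) = trig_poly (hasse_term a y m) K t.
Proof.
  unfold hasse_poly, Cpoly, trig_poly, hasse_term. apply Csum_ext; intros k.
  rewrite Cpow_mult_l, cis_pow, <- RtoC_pow, RtoC_mult; ring.
Qed.

(** The factor by which the weight [binom k m * y ^ k] changes from [k + 1] to [k];
it is nondecreasing in [k] and equals [1] for [(k + 1) (1 - y) = m]. *)
Definition hasse_ratio (y : R) (m k : nat) : R := (INR k + 1 - INR m) / ((INR k + 1) * y).

Lemma hasse_term_S (a : nat -> C) (y : R) (m k : nat) : y <> 0 -> a (S k) <> RtoC 0 ->
  hasse_term a y m k = (RtoC (hasse_ratio y m k) * (a k / a (S k)) * hasse_term a y m (S k))%C.
Proof.
  intros Hy Ha. unfold hasse_term, hasse_ratio.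
  assert (P := pos_INR k).
  replace (binom k m * y ^ k) with ((INR k + 1 - INR m) / ((INR k + 1) * y) * (binom (S k) m * y ^ S k)).
  - rewrite RtoC_mult. field. exact Ha.
  - rewrite <- tech_pow_Rmult.
    transitivity ((INR k + 1 - INR m) * binom (S k) m * y ^ k / (INR k + 1)); [field; lra|].
    rewrite binom_S_l; field; lra.
Qed.

Lemma hasse_term_S_m (a : nat -> C) (y : R) (m k : nat) :
  Cmod (hasse_term a y (S m) k) * (INR m + 1) = Rabs (INR k - INR m) * Cmod (hasse_term a y m k).
Proof.
  unfold hasse_term. rewrite !Cmod_mult, !Cmod_R.
  assert (E := f_equal Rabs (binom_S_r k m)). rewrite !Rabs_mult in *.
  rewrite (Rabs_pos_eq (INR m + 1)) in E by (generalize (pos_INR m); lra).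
  apply (f_equal (fun v => v * (Rabs (y ^ k) * Cmod (a k)))) in E. lra.
Qed.

Lemma argmax_exists (u : nat -> R) (N : nat) :
  exists n, (n <= N)%nat /\ forall k, (k <= N)%nat -> u k <= u n.
Proof.
  induction N as [|N [n [Hn H]]].
  - exists 0%nat; split; [lia|]. intros k Hk; replace k with 0%nat by lia; lra.
  - destruct (Rle_dec (u (S N)) (u n)) as [Hle|Hgt].
    + exists n; split; [lia|]. intros k Hk.
      destruct (Nat.eq_dec k (S N)) as [->|Hne]; [assumption|apply H; lia].
    + exists (S N); split; [lia|]. intros k Hk.
      destruct (Nat.eq_dec k (S N)) as [->|Hne]; [lra|].
      specialize (H k ltac:(lia)); lra.
Qed.

Definition is_peak (u : nat -> C) (n : nat) : Prop := forall k, Cmod (u k) <= Cmod (u n).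

(** Division by zero has a value too, so that nonvanishing is asked for separately. *)
Definition quotient_tends_to_one (a : nat -> C) : Prop :=
  forall e, 0 < e -> exists N, forall k, (N <= k)%nat ->
    a k <> RtoC 0 /\ Cmod (a k / a (S k) - 1) <= e.

Lemma Cmod_near_one (q : C) (e : R) : Cmod (q - 1) <= e -> 1 - e <= Cmod q <= 1 + e.
Proof.
  intros H; split.
  - assert (T := Cmod_triangle q (- (q - 1))). rewrite Cmod_opp in T.
    replace (q + - (q - 1))%C with (RtoC 1) in T by ring. rewrite Cmod_1 in T. lra.
  - replace q with ((q - 1) + 1)%C by ring.
    eapply Rle_trans; [apply Cmod_triangle|]. rewrite Cmod_1; lra.
Qed.

(** For large [k] the weights decrease by a factor close to [1 - d], which the slow
variation of [a] cannot compensate, so the terms eventually decrease. *)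
Lemma peak_exists (a : nat -> C) (d : R) (m : nat) : 0 < d < 1 ->
  quotient_tends_to_one a -> a m <> RtoC 0 ->
  exists n, is_peak (hasse_term a (1 - d) m) n /\ (m <= n)%nat.
Proof.
  intros Hd Ha Ham. set (u := hasse_term a (1 - d) m).
  destruct (Ha (d / 2) ltac:(lra)) as [N HN].
  destruct (nfloor_ex (2 * INR m / d)) as [N' HN'].
  { apply Rcomplements.Rdiv_le_0_compat; [generalize (pos_INR m)|]; lra. }
  pose (k1 := (N + N')%nat).
  assert (Hdec : forall k, (k1 <= k)%nat -> Cmod (u (S k)) <= Cmod (u k)).
  { intros k Hk. unfold k1 in Hk.
    destruct (HN k ltac:(lia)) as [_ Hq]. destruct (HN (S k) ltac:(lia)) as [HS _].
    unfold u at 2. rewrite (hasse_term_S a (1 - d) m k) by (try lra; assumption). fold u.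
    rewrite !Cmod_mult, Cmod_R.
    assert (Hk' : 2 * INR m / d <= INR k + 1).
    { assert (H := le_INR N' k ltac:(lia)). lra. }
    assert (Pm := pos_INR m). assert (Pk := pos_INR k).
    assert (Hkm : 2 * INR m <= (INR k + 1) * d).
    { apply (Rmult_le_compat_r d) in Hk'; [|lra].
      unfold Rdiv in Hk'. rewrite Rmult_assoc, Rinv_l in Hk' by lra. lra. }
    apply Cmod_near_one in Hq.
    assert (Hr : (1 - d / 2) / (1 - d) <= hasse_ratio (1 - d) m k).
    { unfold hasse_ratio. apply (Rmult_le_reg_r ((INR k + 1) * (1 - d))); [nra|].
      replace ((1 - d / 2) / (1 - d) * ((INR k + 1) * (1 - d)))
        with ((1 - d / 2) * (INR k + 1)) by (field; lra).
      replace ((INR k + 1 - INR m) / ((INR k + 1) * (1 - d)) * ((INR k + 1) * (1 - d)))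
        with (INR k + 1 - INR m) by (field; lra). lra. }
    assert (Hy : (1 - d) * ((1 - d / 2) / (1 - d)) = 1 - d / 2) by (field; lra).
    assert (Hr0 : 1 <= (1 - d / 2) / (1 - d)).
    { apply (Rmult_le_reg_l (1 - d)); [lra|]. lra. }
    rewrite Rabs_pos_eq by lra.
    assert (Hprod : 1 <= hasse_ratio (1 - d) m k * Cmod (a k / a (S k))).
    { apply Rle_trans with ((1 - d / 2) / (1 - d) * (1 - d / 2)).
      - apply (Rmult_le_reg_l (1 - d)); [lra|]. rewrite <- Rmult_assoc, Hy. nra.
      - apply Rmult_le_compat; lra. }
    assert (H0 := Cmod_ge_0 (u (S k))). nra. }
  destruct (argmax_exists (fun k => Cmod (u k)) k1) as [n [Hn Hmax]].
  assert (Hpeak : is_peak u n).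
  { intros k. destruct (Nat.le_gt_cases k k1) as [Hk|Hk]; [apply Hmax; assumption|].
    replace k with (k1 + (k - k1))%nat by lia.
    induction (k - k1)%nat as [|j IH].
    - rewrite Nat.add_0_r; apply Hmax; lia.
    - rewrite Nat.add_succ_r. eapply Rle_trans; [apply Hdec; lia|exact IH]. }
  exists n; split; [exact Hpeak|].
  destruct (Nat.le_gt_cases m n) as [Hmn|Hmn]; [assumption|exfalso].
  specialize (Hpeak m). unfold u, hasse_term in Hpeak.
  rewrite (binom_small n m Hmn), binom_diag, !Cmod_mult, !Cmod_R in Hpeak.
  rewrite Rmult_0_l, Rabs_R0, Rmult_0_l, Rmult_1_l in Hpeak.
  assert (0 < Rabs ((1 - d) ^ m)) by (apply Rabs_pos_lt, pow_nonzero; lra).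
  assert (0 < Cmod (a m)) by (apply Cmod_gt_0; assumption). nra.
Qed.

(** Maximality compares the term of index [n] with its two neighbours.  As the
quotients of [a] are close to [1], the weight ratio is at least about [1] on the
right of [n] and at most about [1] on its left; this locates [n] near
[m / (1 - y)]. *)
Lemma peak_ratio (a : nat -> C) (y e : R) (N m n : nat) : 0 < y -> 0 < e <= 1 / 2 ->
  (forall k, (N <= k)%nat -> a k <> RtoC 0 /\ Cmod (a k / a (S k) - 1) <= e) ->
  (N < m)%nat -> (m <= n)%nat -> is_peak (hasse_term a y m) n ->
  0 < Cmod (hasse_term a y m n) /\
  1 <= (1 + e) * hasse_ratio y m n /\ (1 - e) * hasse_ratio y m (pred n) <= 1.
Proof.
  intros Hy He HN HNm Hmn Hpeak. set (u := hasse_term a y m) in *.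
  assert (Hpos : 0 < Cmod (u n)).
  { eapply Rlt_le_trans; [|apply (Hpeak m)]. apply Cmod_gt_0. unfold u, hasse_term.
    rewrite binom_diag, Rmult_1_l. apply Cmult_neq_0; [|apply HN; lia].
    intros E; apply RtoC_inj in E. revert E; apply pow_nonzero; lra. }
  assert (Pm := pos_INR m).
  assert (Hmn' := le_INR m n Hmn).
  assert (Hratio : forall k, INR m <= INR k + 1 -> 0 <= hasse_ratio y m k).
  { intros k Hk; unfold hasse_ratio. assert (Pk := pos_INR k).
    apply Rcomplements.Rdiv_le_0_compat; [lra|nra]. }
  split; [exact Hpos|]. split.
  - destruct (HN n ltac:(lia)) as [_ Hq]. destruct (HN (S n) ltac:(lia)) as [HS _].
    apply Cmod_near_one in Hq. specialize (Hratio n ltac:(lra)).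
    assert (E := hasse_term_S a y m n ltac:(lra) HS). fold u in E.
    apply (f_equal Cmod) in E. rewrite !Cmod_mult, Cmod_R, Rabs_pos_eq in E by exact Hratio.
    specialize (Hpeak (S n)).
    apply (Rmult_le_reg_r (Cmod (u n))); [exact Hpos|]. rewrite Rmult_1_l, E at 1.
    rewrite (Rmult_comm (1 + e)).
    apply Rmult_le_compat; [|apply Cmod_ge_0| |exact Hpeak].
    + apply Rmult_le_pos; [exact Hratio|apply Cmod_ge_0].
    + apply Rmult_le_compat_l; lra.
  - destruct n as [|n]; [lia|]. simpl pred.
    destruct (HN n ltac:(lia)) as [_ Hq]. destruct (HN (S n) ltac:(lia)) as [HS _].
    apply Cmod_near_one in Hq. rewrite S_INR in Hmn'. specialize (Hratio n ltac:(lra)).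
    assert (E := hasse_term_S a y m n ltac:(lra) HS). fold u in E.
    apply (f_equal Cmod) in E. rewrite !Cmod_mult, Cmod_R, Rabs_pos_eq in E by exact Hratio.
    specialize (Hpeak n).
    apply (Rmult_le_reg_r (Cmod (u (S n)))); [exact Hpos|]. rewrite Rmult_1_l.
    eapply Rle_trans; [|exact Hpeak]. rewrite E.
    apply Rmult_le_compat_r; [apply Cmod_ge_0|]. rewrite Rmult_comm.
    apply Rmult_le_compat_l; lra.
Qed.

Lemma hasse_ratio_lipschitz (y : R) (m k k' : nat) : 0 < y -> (m <= S k')%nat ->
  Rabs (hasse_ratio y m k - hasse_ratio y m k') <= Rabs (INR k - INR k') / (y * (INR k + 1)).
Proof.
  intros Hy Hm. apply le_INR in Hm. rewrite S_INR in Hm.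
  assert (Pk := pos_INR k). assert (Pk' := pos_INR k'). assert (Pm := pos_INR m).
  replace (hasse_ratio y m k - hasse_ratio y m k')
    with ((INR k - INR k') * (INR m / (INR k' + 1)) * / (y * (INR k + 1)))
    by (unfold hasse_ratio; field; lra).
  rewrite !Rabs_mult. unfold Rdiv at 2.
  rewrite (Rabs_pos_eq (/ (y * (INR k + 1)))) by (left; apply Rinv_0_lt_compat; nra).
  apply Rmult_le_compat_r; [left; apply Rinv_0_lt_compat; nra|].
  rewrite <- (Rmult_1_r (Rabs (INR k - INR k'))) at 2.
  apply Rmult_le_compat_l; [apply Rabs_pos|].
  rewrite Rabs_pos_eq by (apply Rcomplements.Rdiv_le_0_compat; lra).
  apply (Rmult_le_reg_r (INR k' + 1)); [lra|].
  unfold Rdiv; rewrite Rmult_assoc, Rinv_l; lra.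
Qed.

(** At the left end [n - j] is truncated at [0], where there is nothing to compare. *)
Lemma telescope_near (u : nat -> C) (n j : nat) (delta : R) :
  (forall k, (n - j <= k < n + j)%nat -> Cmod (u k - u (S k)) <= delta) ->
  forall k, (n - j <= k <= n + j)%nat -> Cmod (u k - u n) <= INR j * delta.
Proof.
  intros H.
  assert (Hup : forall i, (i <= j)%nat -> Cmod (u (n + i)%nat - u n) <= INR i * delta).
  { induction i as [|i IH]; intros Hi.
    - rewrite Nat.add_0_r. replace (u n - u n)%C with (RtoC 0) by ring.
      rewrite Cmod_0; simpl; lra.
    - rewrite Nat.add_succ_r, S_INR.
      replace (u (S (n + i)) - u n)%C
        with ((u (n + i)%nat - u n) + - (u (n + i)%nat - u (S (n + i))))%C by ring.
      eapply Rle_trans; [apply Cmod_triangle|]. rewrite Cmod_opp.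
      specialize (IH ltac:(lia)). specialize (H (n + i)%nat ltac:(lia)). lra. }
  assert (Hdown : forall i, (i <= j)%nat -> (i <= n)%nat ->
            Cmod (u (n - i)%nat - u n) <= INR i * delta).
  { induction i as [|i IH]; intros Hi Hin.
    - rewrite Nat.sub_0_r. replace (u n - u n)%C with (RtoC 0) by ring.
      rewrite Cmod_0; simpl; lra.
    - rewrite S_INR. specialize (IH ltac:(lia) ltac:(lia)).
      specialize (H (n - S i)%nat ltac:(lia)).
      replace (S (n - S i)) with (n - i)%nat in H by lia.
      replace (u (n - S i)%nat - u n)%C
        with ((u (n - S i)%nat - u (n - i)%nat) + (u (n - i)%nat - u n))%C by ring.
      eapply Rle_trans; [apply Cmod_triangle|]. lra. }
  intros k Hk.
  assert (Hmono : forall i, (i <= j)%nat -> (i = 0)%nat \/ 0 <= delta).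
  { intros i Hi. destruct i as [|i]; [left; reflexivity|right].
    eapply Rle_trans; [apply Cmod_ge_0|apply (H n); lia]. }
  destruct (Nat.le_gt_cases n k) as [Hnk|Hkn].
  - replace k with (n + (k - n))%nat by lia.
    eapply Rle_trans; [apply Hup; lia|].
    destruct (Hmono j ltac:(lia)) as [Hj|Hd].
    + replace (k - n)%nat with j by lia; lra.
    + apply Rmult_le_compat_r; [assumption|apply le_INR; lia].
  - replace k with (n - (n - k))%nat by lia.
    eapply Rle_trans; [apply Hdown; lia|].
    destruct (Hmono j ltac:(lia)) as [Hj|Hd].
    + replace (n - k)%nat with j by lia; lra.
    + apply Rmult_le_compat_r; [assumption|apply le_INR; lia].
Qed.

(** By [peak_ratio] the weight ratio is close to [1] at [n], by
[hasse_ratio_lipschitz] it stays so at distance [j], because the index is at least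
of order [m]; so consecutive terms differ by at most the peak divided by [j + 1]. *)
Lemma flat_near_peak (a : nat -> C) (y : R) (j : nat) : 1 / 2 <= y <= 1 ->
  quotient_tends_to_one a ->
  exists m1, forall m n, (m1 <= m)%nat -> (m <= n)%nat -> is_peak (hasse_term a y m) n ->
    forall k, (n - j <= k <= n + j)%nat ->
      Cmod (hasse_term a y m k - hasse_term a y m n) <= Cmod (hasse_term a y m n).
Proof.
  intros Hy Ha. assert (Pj := pos_INR j).
  pose (e := / (7 * (INR j + 1))).
  assert (He0 : 0 < e) by (apply Rinv_0_lt_compat; lra).
  assert (Hej : 7 * e * (INR j + 1) = 1) by (unfold e; field; lra).
  assert (He : e <= 1 / 7) by nra. clearbody e.
  destruct (Ha e He0) as [N HN].
  destruct (nfloor_ex (2 * (INR j + 1) / e)) as [N' HN'].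
  { apply Rcomplements.Rdiv_le_0_compat; lra. }
  exists (S (N + N' + j)). intros m n Hm Hmn Hpeak.
  destruct (peak_ratio a y e N m n ltac:(lra) ltac:(lra) HN ltac:(lia) Hmn Hpeak)
    as [Hpos [Hlo Hhi]].
  set (u := hasse_term a y m) in *.
  assert (Hgap : forall k k', (n - j <= k <= n + j)%nat -> (k' = n \/ k' = pred n) ->
    Rabs (hasse_ratio y m k - hasse_ratio y m k') <= e).
  { intros k k' Hk Hk'.
    eapply Rle_trans; [apply hasse_ratio_lipschitz; [lra|]|].
    { destruct Hk' as [->| ->]; lia. }
    assert (Hkb : 2 * (INR j + 1) <= e * (INR k + 1)).
    { assert (Hk1 := le_INR N' k ltac:(lia)).
      assert (Hlt : 2 * (INR j + 1) / e <= INR k + 1) by lra.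
      apply (Rmult_le_compat_l e) in Hlt; [|lra].
      replace (e * (2 * (INR j + 1) / e)) with (2 * (INR j + 1)) in Hlt by (field; lra).
      exact Hlt. }
    assert (Hdist : Rabs (INR k - INR k') <= INR j + 1).
    { assert (H1 := le_INR k (n + j) ltac:(lia)). assert (H2 := le_INR n (k + j) ltac:(lia)).
      rewrite plus_INR in H1, H2.
      destruct Hk' as [->| ->]; [apply Rabs_le; lra|].
      destruct n as [|n]; [lia|]. simpl pred. rewrite S_INR in *. apply Rabs_le; lra. }
    assert (Pk := pos_INR k).
    apply (Rmult_le_reg_r (y * (INR k + 1))); [nra|].
    unfold Rdiv; rewrite Rmult_assoc, Rinv_l by nra. nra. }
  assert (Hstep : forall k, (n - j <= k < n + j)%nat ->
    Cmod (u k - u (S k)) <= / (INR j + 1) * Cmod (u n)).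
  { intros k Hk.
    assert (G1 := Hgap k n ltac:(lia) (or_introl eq_refl)).
    assert (G2 := Hgap k (pred n) ltac:(lia) (or_intror eq_refl)).
    apply Rabs_le_between in G1, G2.
    assert (Hr1 : 1 - e <= hasse_ratio y m n) by nra.
    assert (Hr2 : hasse_ratio y m (pred n) <= 1 + 2 * e) by nra.
    set (r := hasse_ratio y m k) in *.
    assert (Hr : 1 - 2 * e <= r <= 1 + 3 * e) by lra.
    destruct (HN k ltac:(lia)) as [_ Hq]. destruct (HN (S k) ltac:(lia)) as [HS _].
    assert (E := hasse_term_S a y m k ltac:(lra) HS). fold u r in E.
    replace (u k - u (S k))%C
      with ((RtoC r * (a k / a (S k) - 1) + RtoC (r - 1)) * u (S k))%C.
    2:{ rewrite E, RtoC_minus; ring. }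
    rewrite Cmod_mult.
    apply Rmult_le_compat; [apply Cmod_ge_0|apply Cmod_ge_0| |apply Hpeak].
    replace (/ (INR j + 1)) with (7 * e).
    2:{ apply (Rmult_eq_reg_r (INR j + 1)); [|lra]. rewrite Rinv_l; lra. }
    eapply Rle_trans; [apply Cmod_triangle|]. rewrite Cmod_mult, !Cmod_R.
    rewrite (Rabs_pos_eq r) by lra.
    assert (Rabs (r - 1) <= 3 * e) by (apply Rabs_le; lra).
    assert (r * Cmod (a k / a (S k) - 1) <= 2 * e).
    { apply Rmult_le_compat; try lra. apply Cmod_ge_0. }
    lra. }
  intros k Hk.
  eapply Rle_trans; [apply (telescope_near u n j _ Hstep k Hk)|].
  rewrite <- Rmult_assoc. rewrite <- (Rmult_1_l (Cmod (u n))) at 2.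
  apply Rmult_le_compat_r; [lra|].
  apply (Rmult_le_reg_r (INR j + 1)); [lra|]. rewrite Rmult_assoc, Rinv_l; lra.
Qed.

(** The peak of order [m] is a competitor for order [m + 1], with gain
[(n - m) / (m + 1)].  As [n + 1 >= m / (5 d / 4)], this gain is at least
[6 / 5 * (1 - d) / (2 d)]; the limiting value would be [(1 - d) / d]. *)
Lemma peak_growth (a : nat -> C) (d : R) : 0 < d <= 1 / 9 -> quotient_tends_to_one a ->
  exists c m1, 0 < c /\ forall i, exists k,
    c * (6 / 5 * ((1 - d) / (2 * d))) ^ i <= Cmod (hasse_term a (1 - d) (m1 + i) k).
Proof.
  intros Hd Ha.
  destruct (Ha (d / 4) ltac:(lra)) as [N HN].
  pose (m1 := (N + 5)%nat).
  exists (Cmod (hasse_term a (1 - d) m1 m1)), m1. split.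
  - apply Cmod_gt_0. unfold hasse_term. rewrite binom_diag, Rmult_1_l.
    apply Cmult_neq_0; [|apply HN; unfold m1; lia].
    intros E; apply RtoC_inj in E. revert E; apply pow_nonzero; lra.
  - induction i as [|i [k IH]].
    + exists m1. rewrite Nat.add_0_r; simpl; lra.
    + rewrite Nat.add_succ_r. set (m := (m1 + i)%nat) in *.
      destruct (peak_exists a d m ltac:(lra) Ha) as [n [Hpeak Hmn]].
      { apply HN; unfold m, m1; lia. }
      exists n.
      destruct (peak_ratio a (1 - d) (d / 4) N m n ltac:(lra) ltac:(lra) HN
        ltac:(unfold m, m1; lia) Hmn Hpeak) as [Hpos [Hlo _]].
      assert (E := hasse_term_S_m a (1 - d) m n).
      assert (Hm5 := le_INR 5 m ltac:(unfold m, m1; lia)).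
      replace (INR 5) with 5 in Hm5 by (simpl; ring).
      assert (Hmn' := le_INR m n Hmn).
      rewrite Rabs_pos_eq in E by lra.
      assert (Hn : INR m <= 5 / 4 * d * (INR n + 1)).
      { unfold hasse_ratio in Hlo.
        apply (Rmult_le_compat_r ((INR n + 1) * (1 - d))) in Hlo; [|nra].
        replace ((1 + d / 4) * ((INR n + 1 - INR m) / ((INR n + 1) * (1 - d)))
                 * ((INR n + 1) * (1 - d)))
          with ((1 + d / 4) * (INR n + 1 - INR m)) in Hlo by (field; lra).
        assert (0 <= d / 4 * INR m) by (apply Rmult_le_pos; lra). nra. }
      assert (Hgain : 6 / 5 * ((1 - d) / (2 * d)) * (INR m + 1) <= INR n - INR m).
      { apply (Rmult_le_reg_r d); [lra|].
        replace (6 / 5 * ((1 - d) / (2 * d)) * (INR m + 1) * d)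
          with (3 / 5 * (1 - d) * (INR m + 1)) by (field; lra).
        nra. }
      assert (Hk := Hpeak k).
      set (q := 6 / 5 * ((1 - d) / (2 * d))) in *.
      assert (Hq : 0 < q).
      { unfold q. apply Rmult_lt_0_compat; [lra|apply Rdiv_lt_0_compat; lra]. }
      apply (Rmult_le_reg_r (INR m + 1)); [lra|]. rewrite E.
      set (c := Cmod (hasse_term a (1 - d) m1 m1)) in *.
      apply Rle_trans with (q * (INR m + 1) * Cmod (hasse_term a (1 - d) m n)).
      * replace (c * q ^ S i * (INR m + 1)) with (q * (INR m + 1) * (c * q ^ i)) by (simpl; ring).
        apply Rmult_le_compat_l; [nra|lra].
      * apply Rmult_le_compat_r; lra.
Qed.

(** * Fabry's theorem *)

(** The peak of order [m] is at most [2 M w^m] by the average over the arc, with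
[w = (1 - d) / (2 d)], and at least of order [(6 / 5 * w)^m]. *)
Lemma not_regular_at_one (a : nat -> C) (g : C -> C) (r : R) : 0 < r ->
  quotient_tends_to_one a ->
  (forall z, Cmod z < 1 -> is_pseries (V := C_NormedModule) a z (g z)) ->
  ~ (forall z, Cmod (z - 1) < r -> complex_derivable g z).
Proof.
  intros Hr Ha Hps Hg.
  pose (d := Rmin r 1 / 9).
  assert (Hd : 0 < d <= 1 / 9 /\ 9 * d <= r).
  { unfold d. assert (H1 := Rmin_l r 1). assert (H2 := Rmin_r r 1).
    assert (H3 : 0 < Rmin r 1) by (apply Rmin_pos; lra). lra. }
  clearbody d. destruct Hd as [Hd Hdr].
  destruct (hasse_poly_bound_near_one a g d Hd Hps) as [M [HM0 HM]].
  { intros z Hz; apply Hg; lra. }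
  destruct (nfloor_ex (256 / d ^ 2 + 1)) as [j' Hj'].
  { assert (0 <= 256 / d ^ 2); [|lra].
    apply Rcomplements.Rdiv_le_0_compat; [lra|apply pow_lt; lra]. }
  pose (j := S j').
  assert (Hj : 256 / d ^ 2 + 1 <= INR j) by (unfold j; rewrite S_INR; lra).
  assert (Hd2 : 0 < 256 / d ^ 2) by (apply Rdiv_lt_0_compat; [lra|apply pow_lt; lra]).
  destruct (flat_near_peak a (1 - d) j ltac:(lra) Ha) as [m2 Hflat].
  destruct (peak_growth a d Hd Ha) as [c [m1 [Hc Hgrow]]].
  destruct (Ha 1 ltac:(lra)) as [N0 HN0].
  set (w := (1 - d) / (2 * d)) in *.
  assert (Hw : 0 < w) by (apply Rdiv_lt_0_compat; lra).
  assert (Hi : exists i, (N0 + m2 <= m1 + i)%nat /\ 2 * M * w ^ m1 < c * (6 / 5) ^ i).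
  { destruct (Pow_x_infinity (6 / 5) ltac:(rewrite Rabs_pos_eq; lra) (2 * M * w ^ m1 / c + 1))
      as [i0 Hi0].
    exists (i0 + N0 + m2)%nat. split; [lia|].
    specialize (Hi0 (i0 + N0 + m2)%nat ltac:(lia)).
    rewrite Rabs_pos_eq in Hi0 by (apply pow_le; lra).
    replace (2 * M * w ^ m1) with (c * (2 * M * w ^ m1 / c)) by (field; lra).
    apply Rmult_lt_compat_l; lra. }
  destruct Hi as [i [Him Hbig]].
  set (m := (m1 + i)%nat) in *.
  destruct (peak_exists a d m ltac:(lra) Ha) as [n [Hpeak Hmn]].
  { apply HN0; lia. }
  destruct (HM m) as [K0 HK0].
  assert (Hup : Cmod (hasse_term a (1 - d) m n) <= 2 * (M * w ^ m)).
  { apply (peak_le_arc_sup (hasse_term a (1 - d) m) (K0 + n) n (INR j) d).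
    - lra.
    - lia.
    - lra.
    - lra.
    - exact Hpeak.
    - intros k Hk. apply Hflat; try lia; [exact Hpeak|].
      apply Rabs_le_between in Hk. split.
      + assert (n <= k + j)%nat; [|lia]. apply INR_le. rewrite plus_INR. lra.
      + apply INR_le. rewrite plus_INR. lra.
    - intros t Ht. rewrite <- hasse_poly_circle. apply HK0; [lia|exact Ht]. }
  destruct (Hgrow i) as [k Hk]. fold m in Hk. specialize (Hpeak k).
  assert (Hwi : 0 < w ^ i) by (apply pow_lt; assumption).
  unfold m in Hup at 2. rewrite pow_add in Hup. rewrite Rpow_mult_distr in Hk. nra.
Qed.

(** If [|s| < t < 1], then [|a_k t^k|] eventually increases, whereas it tends to [0]. *)
Lemma quotient_limit_ge_1 (a : nat -> C) (s : C) :
  (forall e, 0 < e -> exists N, forall k, (N <= k)%nat ->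
     a k <> RtoC 0 /\ Cmod (a k / a (S k) - s) <= e) ->
  (forall z, Cmod z < 1 -> ex_pseries (V := C_NormedModule) a z) ->
  1 <= Cmod s.
Proof.
  intros Ha Hconv. destruct (Rle_dec 1 (Cmod s)) as [H|H]; [assumption|exfalso].
  assert (Ps := Cmod_ge_0 s).
  pose (t := (1 + Cmod s) / 2). assert (Ht : 0 < t < 1 /\ Cmod s < t) by (unfold t; lra).
  destruct (Ha (t - Cmod s) ltac:(lra)) as [N HN].
  destruct (Hconv (RtoC t)) as [l Hl]; [rewrite Cmod_R, Rabs_pos_eq; lra|].
  assert (Hinc : forall i, Cmod (a N * t ^ N) <= Cmod (a (N + i)%nat * t ^ (N + i))).
  { induction i as [|i IH]; [rewrite Nat.add_0_r; lra|].
    eapply Rle_trans; [exact IH|]. rewrite Nat.add_succ_r.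
    destruct (HN (N + i)%nat ltac:(lia)) as [_ Hq]. destruct (HN (S (N + i)) ltac:(lia)) as [HS _].
    replace (a (N + i)%nat) with (a (N + i)%nat / a (S (N + i)) * a (S (N + i)))%C
      by (field; exact HS).
    set (q := (a (N + i)%nat / a (S (N + i)))%C) in *.
    rewrite Cpow_S, !Cmod_mult, Cmod_R, (Rabs_pos_eq t) by lra.
    assert (Hqt : Cmod q <= t).
    { replace q with ((q - s) + s)%C by ring. eapply Rle_trans; [apply Cmod_triangle|lra]. }
    assert (P1 := Cmod_ge_0 (a (S (N + i)))). assert (P2 := Cmod_ge_0 (t ^ (N + i))%C).
    assert (P3 : 0 <= Cmod (a (S (N + i))) * Cmod (t ^ (N + i))) by (apply Rmult_le_pos; assumption).
    nra. }
  assert (Hpos : 0 < Cmod (a N * t ^ N)).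
  { apply Cmod_gt_0, Cmult_neq_0; [apply HN; lia|]. apply Cpow_nz.
    intros E; apply RtoC_inj in E; lra. }
  destruct (pseries_term_small a t l _ Hl Hpos) as [N' HN'].
  specialize (HN' (N + N')%nat ltac:(lia)). specialize (Hinc N'). lra.
Qed.

(** If [1 < t < t' < |s|], then [|a_k t'^k|] is bounded, so the series converges at [t]. *)
Lemma quotient_limit_le_1 (a : nat -> C) (s : C) :
  (forall e, 0 < e -> exists N, forall k, (N <= k)%nat ->
     a k <> RtoC 0 /\ Cmod (a k / a (S k) - s) <= e) ->
  (forall z, 1 < Cmod z -> ~ ex_pseries (V := C_NormedModule) a z) ->
  Cmod s <= 1.
Proof.
  intros Ha Hdiv. destruct (Rle_dec (Cmod s) 1) as [H|H]; [assumption|exfalso].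
  pose (t := (1 + Cmod s) / 2). pose (t' := (t + Cmod s) / 2).
  assert (Ht : 1 < t < t' /\ t' < Cmod s) by (unfold t', t; lra).
  destruct (Ha (Cmod s - t') ltac:(lra)) as [N HN].
  apply (Hdiv (RtoC t)); [rewrite Cmod_R, Rabs_pos_eq; lra|].
  assert (HB : exists B, forall k, Cmod (a k) * t' ^ k <= B).
  { apply (bounded_of_eventually _ N (Cmod (a N) * t' ^ N)). intros k Hk.
    replace k with (N + (k - N))%nat by lia. induction (k - N)%nat as [|i IH].
    - rewrite Nat.add_0_r; lra.
    - eapply Rle_trans; [|exact IH]. rewrite Nat.add_succ_r.
      destruct (HN (N + i)%nat ltac:(lia)) as [_ Hq]. destruct (HN (S (N + i)) ltac:(lia)) as [HS _].
      replace (a (N + i)%nat) with (a (N + i)%nat / a (S (N + i)) * a (S (N + i)))%C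
        by (field; exact HS).
      set (q := (a (N + i)%nat / a (S (N + i)))%C) in *.
      assert (Hqt : t' <= Cmod q).
      { assert (T := Cmod_triangle q (- (q - s))). rewrite Cmod_opp in T.
        replace (q + - (q - s))%C with s in T by ring. lra. }
      rewrite Cmod_mult. simpl.
      assert (P1 := Cmod_ge_0 (a (S (N + i)))).
      assert (P2 : 0 < t' ^ (N + i)) by (apply pow_lt; lra).
      assert (P3 : 0 <= Cmod (a (S (N + i))) * t' ^ (N + i)) by (apply Rmult_le_pos; lra).
      nra. }
  destruct HB as [B HB].
  apply (ex_series_le (K := C_AbsRing) (V := C_CompleteNormedModule) _
           (fun k => B * (t / t') ^ k)).
  - intros k. change (Cmod (pow_n (K := C_Ring) (RtoC t) k * a k) <= B * (t / t') ^ k).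
    rewrite Cpow_pow_n, Cmod_mult, Cmod_pow, Cmod_R, Rabs_pos_eq by lra.
    replace (t ^ k) with (t' ^ k * (t / t') ^ k).
    2:{ rewrite <- Rpow_mult_distr. f_equal; field; lra. }
    assert (P : 0 <= (t / t') ^ k).
    { apply pow_le, Rcomplements.Rdiv_le_0_compat; lra. }
    specialize (HB k). nra.
  - apply (ex_series_scal (K := R_AbsRing) (V := R_NormedModule) B).
    apply ex_series_geom. rewrite Rabs_pos_eq by (apply Rcomplements.Rdiv_le_0_compat; lra).
    apply (Rmult_lt_reg_r t'); [lra|]. unfold Rdiv; rewrite Rmult_assoc, Rinv_l; lra.
Qed.

Theorem theorem1p1 (a : nat -> C) (f : C -> C) (s : C)
  (Hrad : is_CV_radius_C a 1)
  (Hf : forall z : C, Cmod z < 1 -> is_pseries (V := C_NormedModule) a z (f z))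
  (Hnz : eventually (fun n => a (S n) <> RtoC 0))
  (Hlim : filterlim (fun n => Cdiv (a n) (a (S n))) eventually
            (locally (T := C_UniformSpace) s)) :
  singular_point f s.
Proof.
  assert (Ha : forall e, 0 < e -> exists N, forall k, (N <= k)%nat ->
     a k <> RtoC 0 /\ Cmod (a k / a (S k) - s) <= e).
  { intros e He. destruct Hnz as [N1 H1].
    assert (He2 : 0 < e / 2) by lra.
    destruct (proj1 (filterlim_locally (U := C_UniformSpace) _ s) Hlim (mkposreal _ He2))
      as [N2 H2].
    exists (S (N1 + N2)). intros [|k] Hk; [lia|]. split; [apply H1; lia|].
    destruct (H2 (S k) ltac:(lia)) as [Hre Him].
    eapply Rle_trans; [apply Cmod_le_abs|].
    change (Rabs (Re (a (S k) / a (S (S k)) - s)) < e / 2) in Hre.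
    change (Rabs (Im (a (S k) / a (S (S k)) - s)) < e / 2) in Him. lra. }
  assert (Hs : Cmod s = 1).
  { destruct Hrad as [Hin Hout]. apply Rle_antisym.
    - exact (quotient_limit_le_1 a s Ha Hout).
    - exact (quotient_limit_ge_1 a s Ha Hin). }
  assert (Hs0 : s <> RtoC 0).
  { intros E. rewrite E, Cmod_0 in Hs; lra. }
  split; [exact Hs|]. intros [r [g [Hg Heq]]].
  (* Rotate: the coefficients a_k s^k belong to z |-> f (s z). *)
  apply (not_regular_at_one (fun k => a k * s ^ k)%C (fun z => g (0 + s * z)%C) r (cond_pos r)).
  - intros e He. destruct (Ha e He) as [N HN]. exists N. intros k Hk.
    destruct (HN k Hk) as [H1 H2]. destruct (HN (S k) ltac:(lia)) as [HS _]. split.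
    + apply Cmult_neq_0; [exact H1|apply Cpow_nz; exact Hs0].
    + replace (a k * s ^ k / (a (S k) * s ^ S k) - 1)%C with ((a k / a (S k) - s) * / s)%C.
      * rewrite Cmod_mult, Cmod_inv, Hs by exact Hs0. lra.
      * rewrite Cpow_S. field. repeat split; try assumption. apply Cpow_nz; assumption.
  - intros z Hz.
    assert (Hsz : Cmod (0 + s * z) < 1).
    { replace (0 + s * z)%C with (s * z)%C by ring. rewrite Cmod_mult, Hs; lra. }
    rewrite Heq by exact Hsz.
    apply (is_series_ext (K := C_AbsRing) (V := C_NormedModule)
      (fun k => scal (V := C_NormedModule) (pow_n (K := C_Ring) (0 + s * z)%C k) (a k)));
      [|exact (Hf _ Hsz)].
    intros k.
    change (pow_n (K := C_Ring) (0 + s * z)%C k * a k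
            = pow_n (K := C_Ring) z k * (a k * s ^ k))%C.
    rewrite (Cpow_pow_n (0 + s * z)), (Cpow_pow_n z), Cplus_0_l, Cpow_mult_l; ring.
  - intros z Hz. apply (ex_derive_Ccomp g (fun u => 0 + s * u)%C); [|apply ex_derive_affine].
    apply Hg. right. replace (0 + s * z - s)%C with (s * (z - 1))%C by ring.
    rewrite Cmod_mult, Hs; lra.
Qed.
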